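(* Let $M$ be a microlinear space. Let $A$, $B$, $C$ be spaces with elements $a_0\in A$, $b_0\in B$, $c_0\in C$. Let $\xi_1$ be an $(A,a_0)$-$1$-icon on $M$, $\xi_2$ a $(B,b_0)$-$1$-icon on $M$, and $\xi_3$ a $(C,c_0)$-$1$-icon on $M$. Then, after identifying $B\times C\times A$ and $C\times A\times B$ with $A\times B\times C$ in the natural way (so that all three terms below are mappings $D\to[[A\times B\times C\to M]\to M]$, i.e. tangent vectors at $\delta_{(a_0,b_0,c_0)}$), $$\lfloor \xi_1,\lfloor \xi_2,\xi_3\rfloor\rfloor+\lfloor \xi_2,\lfloor \xi_3,\xi_1\rfloor\rfloor+\lfloor \xi_3,\lfloor \xi_1,\xi_2\rfloor\rfloor=0 ,$$ where sum and zero are those of the tangent space of $[[A\times B\times C\to M]\to M]$ at $\delta_{(a_0,b_0,c_0)}$.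
   Context: Setting: synthetic differential geometry, i.e. (intuitionistic) reasoning inside a cartesian closed universe $\mathcal{E}$ of spaces, as in Lavendhomme's ''Basic Concepts of Synthetic Differential Geometry''. $[X\to Y]$ is the exponential $Y^X$. $\mathbb{R}$ is the line, a commutative ring satisfying the generalized Kock–Lawvere axiom (for each Weil algebra $W$ the canonical map $W\to[\mathrm{Spec}_{\mathbb R}W\to\mathbb{R}]$ is bijective). $D=\{d\in\mathbb{R}: d^2=0\}$, $D(2)=\{(d_1,d_2)\in D^2: d_1d_2=0\}$. A space $X$ is microlinear if every finite diagram of infinitesimal objects $\mathrm{Spec}_{\mathbb R}W$ with cocone which $[-\to\mathbb{R}]$ turns into a limit diagram is also turned into a limit diagram by $[-\to X]$. If $X$ is microlinear, so is $[Y\to X]$ for every space $Y$. Tangent vectors: a tangent vector to a microlinear $X$ at $x$ is $t:D\to X$ with $t(0)=x$. Those at $x$ form an $\mathbb{R}$-module: $(\alpha t)(d)=t(\alpha d)$ and $(t_1+t_2)(d)=l(d,d)$, where $l:D(2)\to X$ is the unique map with $l(d,0)=t_1(d)$, $l(0,d)=t_2(d)$; zero is the constant map. Strong difference: for $\gamma_1,\gamma_2:D^2\to X$ ($X$ microlinear) with $\gamma_1|_{D(2)}=\gamma_2|_{D(2)}$, there is a unique $k:\{(d_1,d_2,e)\in D^3: d_1e=d_2e=0\}\to X$ with $k(d_1,d_2,0)=\gamma_2(d_1,d_2)$ and $k(d_1,d_2,d_1d_2)=\gamma_1(d_1,d_2)$; put $(\gamma_1\overset{\cdot}{-}\gamma_2)(e)=k(0,0,e)$,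 a tangent vector at $\gamma_1(0,0)$. Convolutions: for $f\in[[A\to M]\to M]$, $g\in[[B\to M]\to M]$, define $f\ast g,\ f\,\widetilde{\ast}\,g\in[[A\times B\to M]\to M]$ by $(f\ast g)(h)=f(\lambda a.\,g(\lambda b.\,h(a,b)))$ and $(f\,\widetilde{\ast}\,g)(h)=g(\lambda b.\,f(\lambda a.\,h(a,b)))$. For $a\in A$, the Dirac distribution is $\delta_a=\lambda f\in[A\to M].f(a)$. Icons: an $(A,a_0)$-$n$-icon on $M$ is a map $\xi:D^n\to[[A\to M]\to M]$ with $\xi(0,\dots,0)=\delta_{a_0}$. For an $(A,a_0)$-$1$-icon $\xi_1$ and a $(B,b_0)$-$1$-icon $\xi_2$, put $(\xi_1\circledast\xi_2)(d_1,d_2)=\xi_1(d_1)\ast\xi_2(d_2)$ and $(\xi_1\widetilde{\circledast}\xi_2)(d_1,d_2)=\xi_1(d_1)\,\widetilde{\ast}\,\xi_2(d_2)$; these agree on $D(2)$, and the Lie bracket is $\lfloor\xi_1,\xi_2\rfloor=\xi_1\widetilde{\circledast}\xi_2\overset{\cdot}{-}\xi_1\circledast\xi_2$, an $(A\times B,(a_0,b_0))$-$1$-icon on $M$. Identification: a map $\varphi\in[[B\times C\times A\to M]\to M]$ is regarded as an element of $[[A\times B\times C\to M]\to M]$ by $h\mapsto\varphi(\lambda(b,c,a).\,h(a,b,c))$, and similarly for $C\times A\times B$. *)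

(* Defs.v *)
From HB Require Import structures.
From mathcomp Require Import all_boot all_order all_algebra.
From mathcomp Require Import boolp classical_sets.

Set Implicit Arguments.
Unset Strict Implicit.
Unset Printing Implicit Defensive.

Import GRing.Theory.
Local Open Scope ring_scope.

(** Synthetic differential geometry is intuitionistic reasoning inside a
    cartesian closed category, and it is interpreted here as such: the ambient
    category is a variable and may be any cartesian closed category with finite
    limits.  (Taking Rocq types themselves as spaces would not do: the
    Kock-Lawvere axiom forces R = 0 under excluded middle and choice.)

    Internal statements have their Kripke-Joyal meaning.  An element of X is a
    generalized element, i.e. a morphism g : mor G X from a stage G; it restricts
    along s : mor H G to [g ∘ s]; an internal "for all x in X" is a
    quantification over all later stages s : mor H G and all x : mor H X. *)

Record universe := Universe {
  obj :> Type;
  mor : obj -> obj -> Type;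
  idm : forall X, mor X X;
  mcomp : forall X Y Z, mor Y Z -> mor X Y -> mor X Z;
  mcompA : forall X Y Z T (h : mor Z T) (g : mor Y Z) (f : mor X Y),
    mcomp h (mcomp g f) = mcomp (mcomp h g) f;
  mcomp1m : forall X Y (f : mor X Y), mcomp (idm Y) f = f;
  mcompm1 : forall X Y (f : mor X Y), mcomp f (idm X) = f;
  (* terminal object *)
  terminal : obj;
  bang : forall X, mor X terminal;
  bang_uniq : forall X (f : mor X terminal), f = bang X;
  (* binary products *)
  prd : obj -> obj -> obj;
  pr1 : forall X Y, mor (prd X Y) X;
  pr2 : forall X Y, mor (prd X Y) Y;
  pairm : forall Z X Y, mor Z X -> mor Z Y -> mor Z (prd X Y);
  pr1_pair : forall Z X Y (f : mor Z X) (g : mor Z Y),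
    mcomp (pr1 X Y) (pairm f g) = f;
  pr2_pair : forall Z X Y (f : mor Z X) (g : mor Z Y),
    mcomp (pr2 X Y) (pairm f g) = g;
  pair_uniq : forall Z X Y (h : mor Z (prd X Y)),
    h = pairm (mcomp (pr1 X Y) h) (mcomp (pr2 X Y) h);
  (* equalizers *)
  eqz : forall X Y, mor X Y -> mor X Y -> obj;
  eqz_incl : forall X Y (f g : mor X Y), mor (eqz f g) X;
  eqz_eq : forall X Y (f g : mor X Y),
    mcomp f (eqz_incl f g) = mcomp g (eqz_incl f g);
  eqz_fact : forall X Y (f g : mor X Y) Z (h : mor Z X),
    mcomp f h = mcomp g h -> mor Z (eqz f g);
  eqz_factK : forall X Y (f g : mor X Y) Z (h : mor Z X)
    (fgh : mcomp f h = mcomp g h), mcomp (eqz_incl f g) (eqz_fact fgh) = h;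
  eqz_mono : forall X Y (f g : mor X Y) Z (u v : mor Z (eqz f g)),
    mcomp (eqz_incl f g) u = mcomp (eqz_incl f g) v -> u = v;
  (* exponentials: [expo X Y] is the space of maps from X to Y *)
  expo : obj -> obj -> obj;
  ev : forall X Y, mor (prd (expo X Y) X) Y;
  currym : forall Z X Y, mor (prd Z X) Y -> mor Z (expo X Y);
  ev_curry : forall Z X Y (f : mor (prd Z X) Y),
    mcomp (ev X Y) (pairm (mcomp (currym f) (pr1 Z X)) (pr2 Z X)) = f;
  curry_uniq : forall Z X Y (h : mor Z (expo X Y)),
    h = currym (mcomp (ev X Y) (pairm (mcomp h (pr1 Z X)) (pr2 Z X)))
}.

Arguments mor {_}.
Arguments idm {_}.
Arguments mcomp {_ _ _ _}.
Arguments terminal {_}.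
Arguments bang {_}.
Arguments prd {_}.
Arguments pr1 {_ _ _}.
Arguments pr2 {_ _ _}.
Arguments pairm {_ _ _ _}.
Arguments eqz {_ _ _}.
Arguments eqz_incl {_ _ _ _ _}.
Arguments eqz_fact {_ _ _ _ _ _}.
Arguments expo {_}.
Arguments ev {_ _ _}.
Arguments currym {_ _ _ _}.

Declare Scope sdg_scope.
Delimit Scope sdg_scope with sdg.
Open Scope sdg_scope.

Notation "g ∘ f" := (mcomp g f) (at level 40, left associativity) : sdg_scope.
Notation "X × Y" := (prd X Y) (at level 39, left associativity) : sdg_scope.
Notation "X ⇒ Y" := (expo X Y) (at level 55, right associativity) : sdg_scope.
Notation "⟨ f , g ⟩" := (pairm f g) (at level 0) : sdg_scope.

Section InternalLanguage.
Context {E : universe}.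
Implicit Types G X Y Z : E.

(** [lam F] is the internal "fun x => F x"; the body lives at stage G × X, so
    that the free variables of F must be weakened with ↑. *)
Definition weaken G X Y (f : mor G Y) : mor (G × X) Y := f ∘ pr1.

Definition lam G X Y (F : mor (G × X) X -> mor (G × X) Y) : mor G (X ⇒ Y) :=
  currym (F pr2).

Definition appm G X Y (f : mor G (X ⇒ Y)) (x : mor G X) : mor G Y := ev ∘ ⟨f, x⟩.

Definition precomp X Y Z (f : mor X Y) : mor (Y ⇒ Z) (X ⇒ Z) :=
  currym (ev ∘ ⟨pr1, f ∘ pr2⟩).

Definition is_iso X Y (f : mor X Y) : Prop :=
  exists g : mor Y X, g ∘ f = idm X /\ f ∘ g = idm Y.

Fixpoint powo X (n : nat) : E := if n is n'.+1 then X × powo X n' else terminal.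

Fixpoint coordm X n : 'I_n -> mor (powo X n) X :=
  match n with
  | 0 => fun i => match notF (ltn_ord i) with end
  | n'.+1 => fun i =>
      if unlift ord0 i is Some j then coordm X j ∘ pr2 else pr1
  end.

Fixpoint tuple_of G X n : ('I_n -> mor G X) -> mor G (powo X n) :=
  match n with
  | 0 => fun _ => bang G
  | n'.+1 => fun f => ⟨f ord0, tuple_of (fun i => f (lift ord0 i))⟩
  end.

End InternalLanguage.

Notation "↑ f" := (weaken _ f) (at level 9, f at level 9, format "↑ f")
  : sdg_scope.

HB.instance Definition _ (E : universe) (X Y : E) := gen_eqMixin (mor X Y).
HB.instance Definition _ (E : universe) (X Y : E) := gen_choiceMixin (mor X Y).

Lemma mcomp_pair (E : universe) (W Z X Y : E) (f : mor Z X) (g : mor Z Y)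
  (s : mor W Z) : ⟨f, g⟩ ∘ s = ⟨f ∘ s, g ∘ s⟩.
Proof.
by rewrite [LHS]pair_uniq !mcompA pr1_pair pr2_pair.
Qed.

(** Commutative ring objects; the axioms are stated on generalized elements. *)
Record ring_object (E : universe) := RingObject {
  carrier :> E;
  radd : mor (carrier × carrier) carrier;
  rmul : mor (carrier × carrier) carrier;
  ropp : mor carrier carrier;
  rzero : mor terminal carrier;
  rone : mor terminal carrier;
  raddA : forall G, associative (fun x y : mor G carrier => radd ∘ ⟨x, y⟩);
  raddC : forall G, commutative (fun x y : mor G carrier => radd ∘ ⟨x, y⟩);
  radd0 : forall G,
    left_id (rzero ∘ bang G) (fun x y : mor G carrier => radd ∘ ⟨x, y⟩);
  raddN : forall G,
    left_inverse (rzero ∘ bang G) (fun x : mor G carrier => ropp ∘ x)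
      (fun x y : mor G carrier => radd ∘ ⟨x, y⟩);
  rmulA : forall G, associative (fun x y : mor G carrier => rmul ∘ ⟨x, y⟩);
  rmulC : forall G, commutative (fun x y : mor G carrier => rmul ∘ ⟨x, y⟩);
  rmul1 : forall G,
    left_id (rone ∘ bang G) (fun x y : mor G carrier => rmul ∘ ⟨x, y⟩);
  rmulD : forall G,
    left_distributive (fun x y : mor G carrier => rmul ∘ ⟨x, y⟩)
      (fun x y : mor G carrier => radd ∘ ⟨x, y⟩)
}.

#[warning="-redundant-canonical-projection"]
HB.instance Definition _ (E : universe) (R : ring_object E) (G : E) :=
  GRing.isZmodule.Build (mor G (carrier R))
    (@raddA E R G) (@raddC E R G) (@radd0 E R G) (@raddN E R G).
#[warning="-redundant-canonical-projection"]
HB.instance Definition _ (E : universe) (R : ring_object E) (G : E) :=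
  GRing.Zmodule_isComPzRing.Build (mor G (carrier R))
    (@rmulA E R G) (@rmulC E R G) (@rmul1 E R G) (@rmulD E R G).

Section RingSubstitution.
Context {E : universe} {R : ring_object E}.
Implicit Types G H : E.

Lemma mcomp_mulr G H (x y : mor G R) (s : mor H G) :
  (x * y) ∘ s = (x ∘ s) * (y ∘ s).
Proof. by rewrite /GRing.mul /= -mcompA mcomp_pair. Qed.

Lemma mcomp_0r G H (s : mor H G) : (0 : mor G R) ∘ s = 0.
Proof. by rewrite /GRing.zero /= -mcompA [bang G ∘ s]bang_uniq. Qed.

End RingSubstitution.

(** A Weil algebra over k is an algebra k ⊕ m whose augmentation ideal m = k^n is
    nilpotent; it is given by the multiplication of m. *)
Record weil (k : comPzRingType) := Weil {
  wrank : nat;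
  wmul : 'rV[k]_wrank -> 'rV[k]_wrank -> 'rV[k]_wrank;
  wmul_linear : forall x, linear (wmul x);
  wmulC : commutative wmul;
  wmulA : associative wmul;
  wmul_nilpotent : exists N : nat, forall (x : 'rV[k]_wrank) (s : seq 'rV[k]_wrank),
    size s = N -> foldl wmul x s = 0
}.

Section Weil.
Context {E : universe} (R : ring_object E).

Definition scalars : comPzRingType := mor (terminal : E) (carrier R).

Implicit Types W : weil scalars.

Definition const_at G (a : scalars) : mor G R := a ∘ bang G.

(** An algebra morphism W -> R is determined by the images x_i of the basis e_i of
    m, subject to x_i x_j = \sum_l (e_i e_j)_l x_l. *)
Definition spec_lhs W : mor (powo R (wrank W)) (powo (powo R (wrank W)) (wrank W)) :=
  tuple_of (fun i => tuple_of (fun j => coordm R i * coordm R j)).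

Definition spec_rhs W : mor (powo R (wrank W)) (powo (powo R (wrank W)) (wrank W)) :=
  tuple_of (fun i => tuple_of (fun j =>
    \sum_l const_at _ (wmul (delta_mx 0 i) (delta_mx 0 j) 0 l) * coordm R l)).

Definition Spec W : E := eqz (spec_lhs W) (spec_rhs W).

(** W, with underlying space R × R^n, is mapped to functions on its spectrum by
    (a, (a_i)) |-> fun x => a + \sum_i a_i x_i. *)
Definition kl_map W : mor (R × powo R (wrank W)) (Spec W ⇒ R) :=
  lam (fun x => ↑(pr1 : mor (R × powo R (wrank W)) R) +
    \sum_i ↑(coordm R i ∘ (pr2 : mor (R × powo R (wrank W)) _)) *
           (coordm R i ∘ (eqz_incl ∘ x))).

Definition kock_lawvere : Prop := forall W, is_iso (kl_map W).

(** Cocones under finite diagrams of infinitesimal spaces (the shape is a finite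
    graph). *)
Record inf_cocone := InfCocone {
  vert : finType;
  edge : finType;
  src : edge -> vert;
  tgt : edge -> vert;
  node : vert -> weil scalars;
  arrow : forall e, mor (Spec (node (src e))) (Spec (node (tgt e)));
  apex : weil scalars;
  leg : forall v, mor (Spec (node v)) (Spec apex);
  legP : forall e, leg (tgt e) ∘ arrow e = leg (src e)
}.

Definition turned_into_limit (c : inf_cocone) (X : E) : Prop :=
  forall (G : E) (f : forall v : vert c, mor G (Spec (node v) ⇒ X)),
    (forall e : edge c, precomp X (arrow e) ∘ f (tgt e) = f (src e)) ->
    exists! g : mor G (Spec (apex c) ⇒ X),
      forall v, precomp X (leg v) ∘ g = f v.

Definition microlinear (X : E) : Prop :=
  forall c : inf_cocone, turned_into_limit c R -> turned_into_limit c X.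

End Weil.

Section Infinitesimals.
Context {E : universe} (R : ring_object E).
Implicit Types G : E.

(** D = {d | d^2 = 0} *)
Definition D : E := eqz (idm R * idm R : mor R R) 0.

Definition valD G (d : mor G D) : mor G R := eqz_incl ∘ d.

Lemma inD_subproof G (x : mor G R) : x * x = 0 ->
  (idm R * idm R : mor R R) ∘ x = 0 ∘ x.
Proof. by move=> x2; rewrite mcomp_mulr mcomp_0r mcomp1m. Qed.

Definition inD G (x : mor G R) (x2 : x * x = 0) : mor G D :=
  eqz_fact x (inD_subproof x2).

Lemma valD_inD G (x : mor G R) (x2 : x * x = 0) : valD (inD x2) = x.
Proof. exact: eqz_factK. Qed.

Lemma valD_sqr G (d : mor G D) : valD d * valD d = 0.
Proof.
have : (idm R * idm R : mor R R) ∘ valD d = 0 ∘ valD d.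
  by rewrite !mcompA eqz_eq.
by rewrite mcomp_mulr mcomp_0r mcomp1m.
Qed.

Definition zeroD G : mor G D := inD (mulr0 (0 : mor G R)).

Lemma valD_zero G : valD (zeroD G) = 0.
Proof. exact: valD_inD. Qed.

Lemma mulD_subproof G (d1 d2 : mor G D) :
  (valD d1 * valD d2) * (valD d1 * valD d2) = 0.
Proof. by rewrite mulrACA valD_sqr mul0r. Qed.

Definition mulD G (d1 d2 : mor G D) : mor G D := inD (mulD_subproof d1 d2).

(** D(2) = {(d1, d2) in D^2 | d1 d2 = 0} *)
Definition D2 : E := eqz (valD pr1 * valD pr2 : mor (D × D) R) 0.

Lemma inD2_subproof G (d1 d2 : mor G D) : valD d1 * valD d2 = 0 ->
  (valD pr1 * valD pr2 : mor (D × D) R) ∘ ⟨d1, d2⟩ = 0 ∘ ⟨d1, d2⟩.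
Proof.
by move=> d12; rewrite mcomp_mulr mcomp_0r /valD -!mcompA pr1_pair pr2_pair.
Qed.

Definition inD2 G (d1 d2 : mor G D) (d12 : valD d1 * valD d2 = 0) : mor G D2 :=
  eqz_fact ⟨d1, d2⟩ (inD2_subproof d12).

Lemma axis1_subproof G (d : mor G D) : valD d * valD (zeroD G) = 0.
Proof. by rewrite valD_zero mulr0. Qed.

Lemma axis2_subproof G (d : mor G D) : valD (zeroD G) * valD d = 0.
Proof. by rewrite valD_zero mul0r. Qed.

(** (d, 0), (0, d) and (d, d) *)
Definition axis1 G (d : mor G D) : mor G D2 := inD2 (axis1_subproof d).
Definition axis2 G (d : mor G D) : mor G D2 := inD2 (axis2_subproof d).
Definition diagD2 G (d : mor G D) : mor G D2 := inD2 (valD_sqr d).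

(** D3e = {(d1, d2, e) in D^3 | d1 e = d2 e = 0} *)
Definition D3e : E :=
  eqz (⟨valD (pr1 ∘ pr1) * valD pr2, valD (pr2 ∘ pr1) * valD pr2⟩
         : mor (D × D × D) (R × R))
      ⟨0, 0⟩.

Lemma inD3e_subproof G (d1 d2 e : mor G D) :
  valD d1 * valD e = 0 -> valD d2 * valD e = 0 ->
  (⟨valD (pr1 ∘ pr1) * valD pr2, valD (pr2 ∘ pr1) * valD pr2⟩
     : mor (D × D × D) (R × R)) ∘ ⟨⟨d1, d2⟩, e⟩ = ⟨0, 0⟩ ∘ ⟨⟨d1, d2⟩, e⟩.
Proof.
move=> d1e d2e; rewrite !mcomp_pair !mcomp_mulr !mcomp_0r /valD.
rewrite -!mcompA !(pr1_pair, pr2_pair) -/(valD d1) -/(valD d2) -/(valD e).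
by rewrite d1e d2e.
Qed.

Definition inD3e G (d1 d2 e : mor G D) (d1e : valD d1 * valD e = 0)
    (d2e : valD d2 * valD e = 0) : mor G D3e :=
  eqz_fact ⟨⟨d1, d2⟩, e⟩ (inD3e_subproof d1e d2e).

Lemma mulDl_subproof G (d1 d2 : mor G D) : valD d1 * valD (mulD d1 d2) = 0.
Proof. by rewrite valD_inD mulrA valD_sqr mul0r. Qed.

Lemma mulDr_subproof G (d1 d2 : mor G D) : valD d2 * valD (mulD d1 d2) = 0.
Proof. by rewrite valD_inD mulrCA valD_sqr mulr0. Qed.

(** (d1, d2, 0), (d1, d2, d1 d2) and (0, 0, e) *)
Definition floorD3e G (d1 d2 : mor G D) : mor G D3e :=
  inD3e (axis1_subproof d1) (axis1_subproof d2).
Definition mulD3e G (d1 d2 : mor G D) : mor G D3e :=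
  inD3e (mulDl_subproof d1 d2) (mulDr_subproof d1 d2).
Definition axisD3e G (e : mor G D) : mor G D3e :=
  inD3e (axis2_subproof e) (axis2_subproof e).

End Infinitesimals.

Section Tangent.
Context {E : universe} {R : ring_object E}.
Implicit Types G X : E.
Local Notation D := (D R).

Definition zero_tangent G X (x : mor G X) : mor G (D ⇒ X) := lam (fun=> ↑x).

Definition is_add_map G X (t1 t2 : mor G (D ⇒ X)) (l : mor G (D2 R ⇒ X)) : Prop :=
  forall (H : E) (s : mor H G) (d : mor H D),
    appm (l ∘ s) (axis1 d) = appm (t1 ∘ s) d /\
    appm (l ∘ s) (axis2 d) = appm (t2 ∘ s) d.

(** The unique l such that [is_add_map t1 t2 l]; the default value of [xget] is
    irrelevant for tangent vectors at the same point of a microlinear space. *)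
Definition add_map G X (t1 t2 : mor G (D ⇒ X)) : mor G (D2 R ⇒ X) :=
  xget (lam (fun=> ↑(appm t1 (zeroD R G)))) [set l | is_add_map t1 t2 l].

Definition add_tangent G X (t1 t2 : mor G (D ⇒ X)) : mor G (D ⇒ X) :=
  lam (fun d => appm ↑(add_map t1 t2) (diagD2 d)).

Definition is_diff_map G X (g1 g2 : mor G (D × D ⇒ X)) (k : mor G (D3e R ⇒ X))
    : Prop :=
  forall (H : E) (s : mor H G) (d1 d2 : mor H D),
    appm (k ∘ s) (floorD3e d1 d2) = appm (g2 ∘ s) ⟨d1, d2⟩ /\
    appm (k ∘ s) (mulD3e d1 d2) = appm (g1 ∘ s) ⟨d1, d2⟩.

(** The unique k such that [is_diff_map g1 g2 k]; the default value of [xget] is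
    irrelevant for maps to a microlinear space that agree on D(2). *)
Definition diff_map G X (g1 g2 : mor G (D × D ⇒ X)) : mor G (D3e R ⇒ X) :=
  xget (lam (fun=> ↑(appm g1 ⟨zeroD R G, zeroD R G⟩)))
    [set k | is_diff_map g1 g2 k].

Definition strong_diff G X (g1 g2 : mor G (D × D ⇒ X)) : mor G (D ⇒ X) :=
  lam (fun e => appm ↑(diff_map g1 g2) (axisD3e e)).

End Tangent.

Section Icons.
Context {E : universe}.
Implicit Types G A B M : E.

Definition dist M A : E := (A ⇒ M) ⇒ M.

Definition dirac M G A (a : mor G A) : mor G (dist M A) :=
  lam (fun f => appm f ↑a).

Definition conv M G A B (f : mor G (dist M A)) (g : mor G (dist M B))
    : mor G (dist M (A × B)) :=
  lam (fun h => appm ↑f (lam (fun a =>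
    appm ↑↑g (lam (fun b => appm ↑↑h ⟨↑a, b⟩))))).

Definition convt M G A B (f : mor G (dist M A)) (g : mor G (dist M B))
    : mor G (dist M (A × B)) :=
  lam (fun h => appm ↑g (lam (fun b =>
    appm ↑↑f (lam (fun a => appm ↑↑h ⟨a, ↑b⟩))))).

(** [push u] regards a distribution on A as one on B, along u : A -> B. *)
Definition push M G A B (u : mor A B) (f : mor G (dist M A)) : mor G (dist M B) :=
  lam (fun h => appm ↑f (lam (fun a => appm ↑h (u ∘ a)))).

Context {R : ring_object E}.
Local Notation D := (D R).

Definition is_icon1 M G A (a0 : mor G A) (xi : mor G (D ⇒ dist M A)) : Prop :=
  appm xi (zeroD R G) = dirac M a0.

Definition icon_conv M G A B (xi1 : mor G (D ⇒ dist M A))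
    (xi2 : mor G (D ⇒ dist M B)) : mor G (D × D ⇒ dist M (A × B)) :=
  lam (fun d => conv (appm ↑xi1 (pr1 ∘ d)) (appm ↑xi2 (pr2 ∘ d))).

Definition icon_convt M G A B (xi1 : mor G (D ⇒ dist M A))
    (xi2 : mor G (D ⇒ dist M B)) : mor G (D × D ⇒ dist M (A × B)) :=
  lam (fun d => convt (appm ↑xi1 (pr1 ∘ d)) (appm ↑xi2 (pr2 ∘ d))).

Definition icon_bracket M G A B (xi1 : mor G (D ⇒ dist M A))
    (xi2 : mor G (D ⇒ dist M B)) : mor G (D ⇒ dist M (A × B)) :=
  strong_diff (icon_convt xi1 xi2) (icon_conv xi1 xi2).

Definition icon_push M G A B (u : mor A B) (xi : mor G (D ⇒ dist M A))
    : mor G (D ⇒ dist M B) :=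
  lam (fun d => push u (appm ↑xi d)).

(** (b, (c, a)) |-> (a, (b, c)) and (c, (a, b)) |-> (a, (b, c)) *)
Definition rotate_bca A B C : mor (B × (C × A)) (A × (B × C)) :=
  ⟨pr2 ∘ pr2, ⟨pr1, pr1 ∘ pr2⟩⟩.

Definition rotate_cab A B C : mor (C × (A × B)) (A × (B × C)) :=
  ⟨pr1 ∘ pr2, ⟨pr2 ∘ pr2, pr1⟩⟩.

End Icons.

(* Main.v *)
(** Words without repeated letters, multiplied by shuffling, span a Weil algebra
    (two words with a common letter have product 0).  A point of its spectrum is a
    family of scalars x_w with x_u x_v = \sum x_w over the shuffles w of u and v,
    that is, a group-like noncommutative polynomial.  For the subwords of a single
    word of length n the spectrum is the cube D^n; for the nonempty words in two
    letters it is D3e, with x_(2 1) = e and x_(1 2) = d1 d2 - e.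

    A function on the spectrum has one coefficient for each word, and the
    coefficient of w is seen on the cube of w.  Hence the spectrum is the colimit of
    these cubes, for R and so for every microlinear space.  For three icons and three
    letters, the products of the icons taken in the order given by w agree on common
    subwords, since an icon is a Dirac distribution at 0, and so they glue to a map K
    on the spectrum of all 15 words.  By uniqueness of the gluing, the iterated
    bracket of the icons i, j, k at e is the value of K at the point
    1 + e [X_i, [X_j, X_k]], and sums of tangent vectors along K are computed by
    adding coefficients.  The theorem is thus the Jacobi identity in the free
    associative algebra. *)

From HB Require Import structures.
From mathcomp Require Import all_boot all_order all_algebra.
From mathcomp Require Import boolp classical_sets.
From mathcomp Require Import ring.
Require Import Defs.

Set Implicit Arguments.
Unset Strict Implicit.
Unset Printing Implicit Defensive.

Import GRing.Theory.
Local Open Scope ring_scope.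
Local Open Scope sdg_scope.

(** * Generalized elements: substitution, products and exponentials *)

Section Category.
Context {E : universe}.
Implicit Types G H X Y Z : E.

Lemma compA G X Y Z (h : mor Y Z) (g : mor X Y) (f : mor G X) :
  h ∘ g ∘ f = h ∘ (g ∘ f).
Proof. by rewrite mcompA. Qed.

Definition compE :=
  (mcomp_pair, pr1_pair, pr2_pair, mcomp1m, mcompm1, compA).

Lemma pair_pr X Y : ⟨pr1, pr2⟩ = idm (X × Y).
Proof. by rewrite [RHS]pair_uniq !mcompm1. Qed.

Lemma pair_eta Z X Y (h : mor Z (X × Y)) : ⟨pr1 ∘ h, pr2 ∘ h⟩ = h.
Proof. by rewrite -pair_uniq. Qed.

Lemma weakenE G X Y H (f : mor G Y) (s : mor H G) (x : mor H X) :
  ↑f ∘ ⟨s, x⟩ = f ∘ s.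
Proof. by rewrite /weaken compA pr1_pair. Qed.

Lemma appmS G X Y H (f : mor G (X ⇒ Y)) x (s : mor H G) :
  appm f x ∘ s = appm (f ∘ s) (x ∘ s).
Proof. by rewrite /appm compA mcomp_pair. Qed.

Lemma app_curry G X Y H (f : mor (G × X) Y) (s : mor H G) x :
  appm (currym f ∘ s) x = f ∘ ⟨s, x⟩.
Proof.
rewrite /appm -{2}[f]ev_curry compA mcomp_pair compA pr1_pair pr2_pair.
by [].
Qed.

Lemma app_lam G X Y H (F : mor (G × X) X -> mor (G × X) Y) (s : mor H G) x :
  appm (lam F ∘ s) x = F pr2 ∘ ⟨s, x⟩.
Proof. exact: app_curry. Qed.

(** The generic element suffices: for [s = pr1] and [x = pr2] at stage [G × X] the hypothesis
    equates the uncurried maps. *)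
Lemma expo_ext G X Y (f g : mor G (X ⇒ Y)) :
  (forall H (s : mor H G) x, appm (f ∘ s) x = appm (g ∘ s) x) -> f = g.
Proof.
by move=> fg; rewrite (curry_uniq f) (curry_uniq g); congr currym; apply: fg.
Qed.

Lemma curryS G X Y H (f : mor (G × X) Y) (s : mor H G) :
  currym f ∘ s = currym (f ∘ ⟨s ∘ pr1, pr2⟩).
Proof.
apply: expo_ext => K t x.
by rewrite -mcompA !app_curry !compE.
Qed.

Lemma app_precomp G X Y Z H (f : mor X Y) (g : mor G (Y ⇒ Z)) (s : mor H G) x :
  appm (precomp Z f ∘ g ∘ s) x = appm (g ∘ s) (f ∘ x).
Proof. by rewrite compA app_curry !compE. Qed.

Lemma coord_tuple G X n (f : 'I_n -> mor G X) i :
  coordm X i ∘ tuple_of f = f i.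
Proof.
elim: n f i => [|n IH] f i; first by case: i.
rewrite /=; case: unliftP => [j ->|->]; last by rewrite pr1_pair.
by rewrite compA pr2_pair IH.
Qed.

Lemma powo_ext G X n (p q : mor G (powo X n)) :
  (forall i, coordm X i ∘ p = coordm X i ∘ q) -> p = q.
Proof.
elim: n p q => [|n IH] p q pq; first by rewrite (bang_uniq p) (bang_uniq q).
rewrite -(pair_eta p) -(pair_eta q); congr pairm.
  by have := pq ord0; rewrite /= unlift_none.
apply: IH => i; have := pq (lift ord0 i).
by rewrite /= liftK !compA.
Qed.

End Category.

Section Ring.
Context {E : universe} {R : ring_object E}.
Implicit Types G H : E.

Lemma mcomp_addr G H (x y : mor G R) (s : mor H G) :
  (x + y) ∘ s = (x ∘ s) + (y ∘ s).
Proof. by rewrite /GRing.add /= -mcompA mcomp_pair. Qed.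

Lemma mcomp_1r G H (s : mor H G) : (1 : mor G R) ∘ s = 1.
Proof. by rewrite /GRing.one /= -mcompA [bang G ∘ s]bang_uniq. Qed.

Lemma mcomp_oppr G H (x : mor G R) (s : mor H G) : (- x) ∘ s = - (x ∘ s).
Proof. by rewrite /GRing.opp /= compA. Qed.

Lemma mcomp_sumr G H (I : Type) (r : seq I) (P : pred I) (F : I -> mor G R)
    (s : mor H G) :
  (\sum_(i <- r | P i) F i) ∘ s = \sum_(i <- r | P i) (F i ∘ s).
Proof.
by apply: (big_morph (fun x => x ∘ s)) => [x y|]; rewrite (mcomp_addr, mcomp_0r).
Qed.

Lemma mcomp_natr G H (n : nat) (s : mor H G) : (n%:R : mor G R) ∘ s = n%:R.
Proof.
elim: n => [|n IH]; first by rewrite mcomp_0r.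
by rewrite -natr1 mcomp_addr IH mcomp_1r natr1.
Qed.

End Ring.

(** * Words and their shuffles *)

Section Words.
Context {T : eqType}.
Implicit Types (u v w x z : seq T).

Definition shuf u v w : bool :=
  [&& filter (mem u) w == u, filter (mem v) w == v &
      all (fun a => (a \in u) (+) (a \in v)) w].

Lemma shufC u v w : shuf u v w = shuf v u w.
Proof.
rewrite /shuf andbCA; congr [&& _, _ & _].
by apply: eq_all => a; rewrite addbC.
Qed.

Lemma shuf_subl u v w : shuf u v w -> subseq u w.
Proof. by case/and3P => /eqP <- _ _; apply: filter_subseq. Qed.

Lemma shuf_size u v w : shuf u v w -> size w = (size u + size v)%N.
Proof.
case/and3P => /eqP {2}<- /eqP {2}<- /allP uv.
rewrite !size_filter -(count_predC (mem u) w); congr addn.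
by apply: eq_in_count => a /uv /=; case: (a \in u); case: (a \in v).
Qed.

Lemma shuf_diag u w : shuf u u w -> w = [::].
Proof. by case/and3P => _ _; case: w => [//|a w] /=; rewrite addbb. Qed.

Definition shuf3 u v z w : bool :=
  [&& filter (mem u) w == u, filter (mem v) w == v, filter (mem z) w == z &
      all (fun a => ((a \in u) + (a \in v) + (a \in z) == 1)%N) w].

Lemma shuf3_rot u v z w : shuf3 u v z w = shuf3 v z u w.
Proof.
rewrite /shuf3 [in RHS](eq_all (a2 := fun a =>
    ((a \in u) + (a \in v) + (a \in z) == 1)%N)) => [|a]; last first.
  by rewrite [in LHS]addnC addnA.
by case: (_ == u); case: (_ == v); case: (_ == z).
Qed.

(** The middle word of an iterated shuffle is forced: it collects the letters of [v] and [z] in the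
    order of [w]. A sum over middle words thus has at most one nonzero term. *)
Lemma shuf3P u v z w x :
  shuf v z x && shuf u x w =
  shuf3 u v z w && (x == filter (predU (mem v) (mem z)) w).
Proof.
apply/idP/idP.
  case/andP => /and3P[/eqP xv /eqP xz /allP vz] /and3P[/eqP wu /eqP wx /allP ux].
  have xE a : (a \in x) = (a \in v) || (a \in z).
    apply/idP/idP => [/vz|]; first by case: (_ \in v).
    by case/orP; [rewrite -{1}xv|rewrite -{1}xz]; rewrite mem_filter => /andP[].
  have fE y : {subset y <= x} -> filter (mem y) w = filter (mem y) x.
    move=> yx; rewrite -[in RHS]wx -filter_predI; apply: eq_filter => a /=.
    by case: (boolP (a \in y)) => [/yx ->|].
  apply/andP; split; last by rewrite -{1}wx; apply/eqP/eq_filter => a; rewrite /= xE.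
  rewrite /shuf3 wu eqxx !fE ?xv ?xz ?eqxx; first 1 last.
  - by move=> a az; rewrite xE az orbT.
  - by move=> a av; rewrite xE av.
  apply/allP => a /ux; rewrite xE; have := vz a; rewrite xE.
  by case: (a \in u); case: (a \in v); case: (a \in z) => //= /(_ isT).
case/andP => /and4P[/eqP wu /eqP wv /eqP wz /allP uvz] /eqP xdef.
have xE a : (a \in x) = (a \in w) && ((a \in v) || (a \in z)).
  by rewrite xdef mem_filter andbC.
have wE y a : filter (mem y) w = y -> a \in y -> a \in w.
  by move=> <-; rewrite mem_filter => /andP[].
apply/andP; split; apply/and3P; split.
- rewrite -[X in _ == X]wv xdef -filter_predI; apply/eqP/eq_filter => a /=.
  by case: (a \in v).
- rewrite -[X in _ == X]wz xdef -filter_predI; apply/eqP/eq_filter => a /=.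
  by case: (a \in z); rewrite ?orbT.
- apply/allP => a; rewrite xE => /andP[/uvz].
  by case: (a \in u); case: (a \in v); case: (a \in z).
- by rewrite wu.
- rewrite [X in _ == X]xdef; apply/eqP/eq_in_filter => a aw /=.
  by rewrite xE aw.
- apply/allP => a aw; rewrite xE aw; have := uvz a aw.
  by case: (a \in u); case: (a \in v); case: (a \in z).
Qed.

End Words.

(** The empty word is excluded because it stands for the unit, while a Weil algebra is presented by
    its augmentation ideal. *)
Record complex (T : eqType) := Complex {
  words :> seq (seq T);
  words_uniq : uniq words;
  words_nil : [::] \notin words;
  words_sub : forall u w, w \in words -> subseq u w -> u != [::] -> u \in words
}.

Section Complex.
Context {T : eqType}.
Implicit Types (u v w : seq T) (O : complex T).

Lemma word_nnil O u : u \in words O -> u != [::].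
Proof. by apply: contraTneq => ->; apply: words_nil. Qed.

Fact below_uniq O w : uniq [seq u <- words O | subseq u w].
Proof. exact/filter_uniq/words_uniq. Qed.
Fact below_nil O w : [::] \notin [seq u <- words O | subseq u w].
Proof. by rewrite mem_filter (negPf (words_nil O)) andbF. Qed.
Fact below_sub O w u v : v \in [seq u <- words O | subseq u w] ->
  subseq u v -> u != [::] -> u \in [seq u <- words O | subseq u w].
Proof.
rewrite !mem_filter => /andP[vw vO] uv u0.
by rewrite (subseq_trans uv vw) (words_sub vO).
Qed.

(** For a word of [n] distinct letters in [O] this is the complex of the cube [D^n]; for the empty
    word it is empty and its spectrum is a point. *)
Definition below O w : complex T :=
  Complex (below_uniq O w) (below_nil O w) (@below_sub O w).

Lemma mem_below O w u : (u \in words (below O w)) = subseq u w && (u \in words O).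
Proof. exact: mem_filter. Qed.

(** By [shuf3P] each side is the truth value of a threefold shuffle, which is invariant under cyclic
    rotation. *)
Lemma shuf_assoc O u v z w : u \in words O -> v \in words O -> z \in words O ->
  w \in words O ->
  (\sum_(x <- words O) shuf u v x * shuf x z w =
   \sum_(x <- words O) shuf v z x * shuf u x w)%N.
Proof.
have main u' v' z' : v' \in words O -> w \in words O ->
    (\sum_(x <- words O) shuf v' z' x * shuf u' x w = shuf3 u' v' z' w)%N.
  move=> vO wO; under eq_bigr do rewrite mulnb shuf3P.
  case: (boolP (shuf3 u' v' z' w)) => [s3|_]; last first.
    by rewrite big1.
  (* The only candidate [y] lies in [O]: it is a subword of [w], and it is nonempty because it
     contains the letters of [v']. *)
  set y := filter _ w; rewrite (bigD1_seq y) ?words_uniq //= ?eqxx.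
    by rewrite big1 // => x /negPf ->.
  case/and4P: s3 => _ /eqP wv _ _; apply: (words_sub wO); first exact: filter_subseq.
  apply: contraNneq (word_nnil vO) => y0; rewrite -wv -size_eq0 size_filter -leqn0.
  suff <- : size y = 0%N by rewrite size_filter; apply: sub_count => a /= ->.
  by rewrite y0.
move=> uO vO zO wO; rewrite main // -[in RHS]shuf3_rot -(main z u v) //.
by apply: eq_bigr => x _; rewrite [shuf x z w]shufC.
Qed.

Section Points.
Context {K : comPzRingType}.
Implicit Types (x : seq T -> K).

(** Points are functions on all words, zero outside the complex, so that a point of a smaller
    complex is literally a point of a larger one. *)
Definition is_pt O x : Prop :=
  (forall w, w \notin words O -> x w = 0) /\
  (forall u v, u \in words O -> v \in words O ->
     x u * x v = \sum_(w <- words O | shuf u v w) x w).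

Lemma sum_sub O O' x (P : pred (seq T)) (a : seq T -> K) :
  {subset words O' <= words O} -> (forall w, w \notin words O' -> x w = 0) ->
  \sum_(w <- words O | P w) a w * x w = \sum_(w <- words O' | P w) a w * x w.
Proof.
move=> sub x0; rewrite (bigID (mem (words O'))) /= [X in _ + X]big1 ?addr0; last first.
  by move=> w /andP[_ /x0 ->]; rewrite mulr0.
rewrite -[LHS]big_filter -[RHS]big_filter; apply: perm_big.
apply: uniq_perm; rewrite ?filter_uniq ?words_uniq // => w.
rewrite !mem_filter; case: (P w) => //=.
by case: (boolP (w \in words O')) => [/sub|].
Qed.

(** If a factor lies outside [O'], then so does every shuffle containing it, by closure under
    subwords; both sides of the relation vanish. *)
Lemma is_pt_mono O O' x : {subset words O' <= words O} -> is_pt O' x -> is_pt O x.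
Proof.
move=> sub [x0 xM]; split=> [w|u v uO vO].
  by move=> wO; apply: x0; apply: contraNN wO; apply: sub.
have zero u' v' : u' \in words O -> u' \notin words O' ->
    \sum_(w <- words O | shuf u' v' w) x w = 0.
  move=> u'O u'O'; apply: big1 => w uvw; apply: x0.
  apply: contraNN u'O' => wO'; apply: words_sub wO' (shuf_subl uvw) _.
  exact: word_nnil u'O.
have [uO'|uO'] := boolP (u \in words O'); last by rewrite zero // x0 // mul0r.
have [vO'|vO'] := boolP (v \in words O'); last first.
  by under eq_bigl do rewrite shufC; rewrite zero // [x v]x0 // mulr0.
rewrite xM //; have := sum_sub (shuf u v) (fun=> 1) sub x0.
by under eq_bigr do rewrite mul1r; under [RHS]eq_bigr do rewrite mul1r.
Qed.

Lemma is_pt_sq O x a : is_pt O x -> x [:: a] * x [:: a] = 0.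
Proof.
case=> x0 xM; have [aO|aO] := boolP ([:: a] \in words O); last by rewrite x0 ?mulr0.
rewrite xM //; apply: big1_seq => w /andP[/shuf_diag -> wO].
by move: (words_nil O); rewrite wO.
Qed.

Lemma is_pt0 O : is_pt O (fun=> 0).
Proof. by split=> // u v _ _; rewrite mulr0 big1. Qed.

End Points.
End Complex.

(** * The shuffle algebra of a complex as a Weil algebra *)

Section ShuffleAlgebra.
Context {T : eqType} (k : comPzRingType) (O : complex T).
Implicit Types (a b : 'rV[k]_(size (words O))).

Definition word (i : nat) : seq T := nth [::] (words O) i.

Lemma word_in (i : 'I_(size (words O))) : word i \in words O.
Proof. exact: mem_nth. Qed.

Lemma sum_words (V : nmodType) (F : seq T -> V) :
  \sum_(w <- words O) F w = \sum_(i < size (words O)) F (word i).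
Proof. by rewrite (big_nth [::]) big_mkord. Qed.

Definition shuf_mul a b : 'rV[k]_(size (words O)) :=
  \row_l \sum_i \sum_j a 0 i * b 0 j * (shuf (word i) (word j) (word l))%:R.

Fact shuf_mul_linear a : linear (shuf_mul a).
Proof.
move=> c u v; apply/rowP => l; rewrite !mxE mulr_sumr -big_split /=.
apply: eq_bigr => i _; rewrite mulr_sumr -big_split; apply: eq_bigr => j _ /=.
by rewrite !mxE; ring.
Qed.

Fact shuf_mulC : commutative shuf_mul.
Proof.
move=> a b; apply/rowP => l; rewrite !mxE exchange_big /=.
by apply: eq_bigr => i _; apply: eq_bigr => j _; rewrite shufC [a 0 _ * _]mulrC.
Qed.

Fact shuf_mulA : associative shuf_mul.
Proof.
pose c i j l : k := (shuf (word i) (word j) (word l))%:R.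
have cE (i j m l : 'I_(size (words O))) :
    \sum_(x < size (words O)) c i j x * c x m l = \sum_(x < size (words O)) c j m x * c i x l.
  have e (F G : seq T -> bool) : \sum_(x < size (words O)) (F (word x))%:R * (G (word x))%:R
      = (\sum_(w <- words O) F w * G w)%:R :> k.
    by rewrite natr_sum sum_words; apply: eq_bigr => x _; rewrite natrM.
  rewrite (e (shuf (word i) (word j)) (fun w => shuf w (word m) (word l))).
  rewrite (e (shuf (word j) (word m)) (fun w => shuf (word i) w (word l))).
  by rewrite shuf_assoc ?word_in.
move=> u v z; apply/rowP => l; rewrite !mxE.
transitivity (\sum_i \sum_j \sum_m u 0 i * v 0 j * z 0 m *
  \sum_(x < size (words O)) c j m x * c i x l).
  apply: eq_bigr => i _; under eq_bigr do rewrite mxE mulr_sumr mulr_suml.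
  rewrite exchange_big /=; apply: eq_bigr => j _.
  under eq_bigr do rewrite mulr_sumr mulr_suml.
  rewrite exchange_big /=; apply: eq_bigr => m _.
  by rewrite mulr_sumr; apply: eq_bigr => x _; rewrite -/(c _ _ _) -/(c _ _ _); ring.
transitivity (\sum_m \sum_i \sum_j u 0 i * v 0 j * z 0 m *
  \sum_(x < size (words O)) c i j x * c x m l).
  rewrite [RHS]exchange_big /=; apply: eq_bigr => i _; rewrite [RHS]exchange_big /=.
  by apply: eq_bigr => j _; apply: eq_bigr => m _; rewrite cE.
rewrite [RHS]exchange_big; apply: eq_bigr => m _ /=.
under [RHS]eq_bigr do rewrite mxE !mulr_suml.
rewrite [RHS]exchange_big; apply: eq_bigr => i _ /=.
under [RHS]eq_bigr do rewrite !mulr_suml.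
rewrite [RHS]exchange_big; apply: eq_bigr => j _ /=.
by rewrite mulr_sumr; apply: eq_bigr => x _; rewrite -/(c _ _ _) -/(c _ _ _); ring.
Qed.

(** Words are nonempty, so each multiplication raises the least length of a word with nonzero
    coefficient; after as many factors as the longest word has letters, nothing remains. *)
Fact shuf_mul_nilpotent : exists N : nat,
  forall a (s : seq 'rV[k]_(size (words O))), size s = N -> foldl shuf_mul a s = 0.
Proof.
pose low n a := forall l : 'I_(size (words O)), (size (word l) <= n)%N -> a 0 l = 0.
have step n a b : low n a -> low n.+1 (shuf_mul a b).
  move=> lowa l lSn; rewrite mxE big1 // => i _; rewrite big1 // => j _.
  case: (boolP (shuf _ _ _)) => [/shuf_size sz|_]; last by rewrite mulr0.
  rewrite lowa ?mul0r //; rewrite sz in lSn.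
  have : (0 < size (word j))%N by rewrite lt0n size_eq0 (word_nnil (word_in j)).
  move: lSn; case: (size (word j)) => // p; rewrite addnS ltnS => + _.
  by apply: leq_trans; rewrite leq_addr.
exists (\max_(i < size (words O)) size (word i)) => a s sN.
have low_foldl n b : low n b -> low (n + size s)%N (foldl shuf_mul b s).
  elim: s {sN} n b => [|b' s IH] n b lowb; first by rewrite addn0.
  by rewrite /= addnS -addSn; apply: IH; apply: step.
apply/rowP => l; rewrite [RHS]mxE; apply: (low_foldl 0%N).
  move=> i; rewrite leqn0 size_eq0 => /eqP wi.
  by have := word_nnil (word_in i); rewrite wi.
by rewrite add0n sN (leq_bigmax (F := fun i : 'I__ => size (word i)) l).
Qed.

Definition shuf_weil : weil k :=
  Weil shuf_mul_linear shuf_mulC shuf_mulA shuf_mul_nilpotent.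

Lemma shuf_mul_delta i j l :
  shuf_mul (delta_mx 0 i) (delta_mx 0 j) 0 l = (shuf (word i) (word j) (word l))%:R.
Proof.
rewrite mxE (bigD1 i) //= (bigD1 j) //= !mxE !eqxx mul1r mul1r.
rewrite !big1 ?addr0 // => [i' /negPf i'i|j' /negPf j'j].
  by rewrite big1 // => j' _; rewrite !mxE i'i mul0r mul0r.
by rewrite !mxE j'j mulr0 mul0r.
Qed.

End ShuffleAlgebra.

(** * Points of the spectrum of a shuffle algebra *)

Section Spectrum.
Context {E : universe} (R : ring_object E) {T : eqType}.
Implicit Types (G H X : E) (O : complex T).

Definition shuf_spec O : E := Spec (shuf_weil (scalars R) O).

Definition coords O H (p : mor H (shuf_spec O)) (w : seq T) : mor H R :=
  if insub (index w (words O)) is Some i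
  then coordm R (i : 'I_(wrank (shuf_weil (scalars R) O))) ∘ (eqz_incl ∘ p)
  else 0.

Lemma coords_word O H (p : mor H (shuf_spec O)) (i : 'I_(size (words O))) :
  coords p (word O i) =
  coordm R (i : 'I_(wrank (shuf_weil (scalars R) O))) ∘ (eqz_incl ∘ p).
Proof.
by rewrite /coords /word index_uniq ?words_uniq // valK.
Qed.

Lemma word_index O w : w \in words O -> exists i : 'I_(size (words O)), w = word O i.
Proof.
move=> wO; have ltw : (index w (words O) < size (words O))%N by rewrite index_mem.
by exists (Ordinal ltw); rewrite /word nth_index.
Qed.

Lemma shuf_spec_lhs O H (q : mor H (powo R (size (words O)))) i j :
  coordm R j ∘ (coordm _ i ∘ (spec_lhs (shuf_weil (scalars R) O) ∘ q)) =
  (coordm R i ∘ q) * (coordm R j ∘ q).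
Proof.
rewrite /spec_lhs [coordm _ i ∘ _]mcompA coord_tuple mcompA coord_tuple.
by rewrite mcomp_mulr.
Qed.

Lemma shuf_spec_rhs O H (q : mor H (powo R (size (words O)))) i j :
  coordm R j ∘ (coordm _ i ∘ (spec_rhs (shuf_weil (scalars R) O) ∘ q)) =
  \sum_(l < size (words O)) (shuf (word O i) (word O j) (word O l))%:R * (coordm R l ∘ q).
Proof.
rewrite /spec_rhs [coordm _ i ∘ _]mcompA coord_tuple mcompA coord_tuple mcomp_sumr.
apply: eq_bigr => l _.
by rewrite mcomp_mulr /const_at shuf_mul_delta compA mcomp_natr.
Qed.

Lemma sum_shuf O (K : comPzRingType) (x : seq T -> K) u v :
  \sum_(w <- words O | shuf u v w) x w =
  \sum_(l < size (words O)) (shuf u v (word O l))%:R * x (word O l).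
Proof.
rewrite big_mkcond (sum_words O (fun w => if shuf u v w then x w else 0)).
by apply: eq_bigr => l _; case: shuf; rewrite (mul1r, mul0r).
Qed.

Lemma coords_pt O H (p : mor H (shuf_spec O)) : is_pt O (coords p).
Proof.
split=> [w wO|u v /word_index[i ->] /word_index[j ->]].
  by rewrite /coords insubF // ltnNge leqNgt index_mem (negPf wO).
rewrite sum_shuf; under eq_bigr do rewrite coords_word.
rewrite !coords_word -shuf_spec_lhs -shuf_spec_rhs.
by congr (_ ∘ (_ ∘ _)); rewrite !mcompA; congr (_ ∘ _); apply: eqz_eq.
Qed.

Lemma spec_pt_subproof O H (x : seq T -> mor H R) : is_pt O x ->
  spec_lhs (shuf_weil (scalars R) O) ∘
    tuple_of (fun i : 'I_(size (words O)) => x (word O i)) =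
  spec_rhs (shuf_weil (scalars R) O) ∘
    tuple_of (fun i : 'I_(size (words O)) => x (word O i)).
Proof.
case=> _ xM; apply: powo_ext => i; apply: powo_ext => j.
rewrite shuf_spec_lhs shuf_spec_rhs !coord_tuple xM ?word_in // sum_shuf.
by apply: eq_bigr => l _; rewrite coord_tuple.
Qed.

(** The default value, the base point, is only there to make the map total. *)
Definition spec_pt O H (x : seq T -> mor H R) : mor H (shuf_spec O) :=
  match pselect (is_pt O x) with
  | left px => eqz_fact _ (spec_pt_subproof px)
  | right _ => eqz_fact _ (spec_pt_subproof (is_pt0 O))
  end.

Lemma coords_spec_pt O H (x : seq T -> mor H R) :
  is_pt O x -> coords (spec_pt O x) = x.
Proof.
move=> px; apply: funext => w.
have [/word_index[i ->]|wO] := boolP (w \in words O); last first.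
  by rewrite (coords_pt _).1 // px.1.
rewrite coords_word /spec_pt; case: pselect => // px'.
by rewrite eqz_factK coord_tuple.
Qed.

Lemma spec_eq O H (p q : mor H (shuf_spec O)) : coords p = coords q -> p = q.
Proof.
move=> pq; apply: eqz_mono; apply: powo_ext => i.
by have := congr1 (fun f => f (word O i)) pq; rewrite !coords_word.
Qed.

Lemma spec_pt_coords O H (p : mor H (shuf_spec O)) : spec_pt O (coords p) = p.
Proof. by apply: spec_eq; rewrite coords_spec_pt //; apply: coords_pt. Qed.

Lemma coordsS O G H (p : mor G (shuf_spec O)) (s : mor H G) w :
  coords p w ∘ s = coords (p ∘ s) w.
Proof. by rewrite /coords; case: insub => [i|]; rewrite ?mcomp_0r // !compA. Qed.

Lemma is_ptS O G H (x : seq T -> mor G R) (s : mor H G) :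
  is_pt O x -> is_pt O (fun w => x w ∘ s).
Proof.
case=> x0 xM; split=> [w wO|u v uO vO]; first by rewrite x0 ?mcomp_0r.
by rewrite -mcomp_mulr xM // mcomp_sumr.
Qed.

Lemma spec_ptS O G H (x : seq T -> mor G R) (s : mor H G) : is_pt O x ->
  spec_pt O x ∘ s = spec_pt O (fun w => x w ∘ s).
Proof.
move=> px; apply: spec_eq; rewrite coords_spec_pt; last exact: is_ptS.
by apply: funext => w; rewrite -coordsS coords_spec_pt.
Qed.

Definition val_at O X G H (k : mor G (shuf_spec O ⇒ X)) (s : mor H G)
    (x : seq T -> mor H R) : mor H X :=
  appm (k ∘ s) (spec_pt O x).

Definition family X G := forall H, mor H G -> (seq T -> mor H R) -> mor H X.

Definition natural O X G (F : family X G) : Prop :=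
  forall H (s : mor H G) x H' (t : mor H' H), is_pt O x ->
    F H s x ∘ t = F H' (s ∘ t) (fun w => x w ∘ t).

Lemma val_at_natural O X G (k : mor G (shuf_spec O ⇒ X)) :
  natural O (fun H => val_at k (H := H)).
Proof.
by move=> H s x H' t px; rewrite /val_at appmS compA spec_ptS.
Qed.

(** The Yoneda construction: a natural family is determined by its value at the generic point, which
    lives at stage [G × shuf_spec O]. *)
Definition map_of O X G (F : family X G) : mor G (shuf_spec O ⇒ X) :=
  currym (F _ pr1 (coords pr2)).

Lemma val_at_map_of O X G (F : family X G) H (s : mor H G) x :
  natural O F -> is_pt O x -> val_at (map_of O F) s x = F H s x.
Proof.
move=> natF px; rewrite /val_at app_curry natF; last exact: coords_pt.
rewrite pr1_pair; congr F; apply: funext => w.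
by rewrite coordsS pr2_pair coords_spec_pt.
Qed.

Lemma map_ext O X G (k k' : mor G (shuf_spec O ⇒ X)) :
  (forall H (s : mor H G) x, is_pt O x -> val_at k s x = val_at k' s x) -> k = k'.
Proof.
move=> kk'; apply: expo_ext => H s p; have := kk' H s _ (coords_pt p).
by rewrite /val_at spec_pt_coords.
Qed.

Section KockLawvere.
Hypothesis KL : kock_lawvere R.

Definition poly O G (a0 : mor G R) (a : seq T -> mor G R) H (s : mor H G)
    (x : seq T -> mor H R) : mor H R :=
  a0 ∘ s + \sum_(w <- words O) (a w ∘ s) * x w.

Lemma app_kl_map O G H (c : mor G (R × powo R (size (words O)))) (s : mor H G)
    (x : seq T -> mor H R) : is_pt O x ->
  val_at (kl_map (shuf_weil (scalars R) O) ∘ c) s x =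
  poly O (pr1 ∘ c) (fun w => if insub (index w (words O)) is Some i
                             then coordm R i ∘ (pr2 ∘ c) else 0) s x.
Proof.
move=> px; rewrite /val_at compA app_lam mcomp_addr mcomp_sumr /poly.
congr (_ + _); first by rewrite weakenE compA.
rewrite (sum_words O (fun w => _ * x w)); apply: eq_bigr => i _.
rewrite mcomp_mulr weakenE /word index_uniq ?words_uniq // valK !compA pr2_pair.
by rewrite -(coords_word (spec_pt O x)) coords_spec_pt.
Qed.

(** This is the surjectivity half of the Kock-Lawvere axiom. *)
Lemma poly_exists O G (f : mor G (shuf_spec O ⇒ R)) :
  exists a0 a, forall H (s : mor H G) x, is_pt O x -> val_at f s x = poly O a0 a s x.
Proof.
have [g [_ kg]] := KL (shuf_weil (scalars R) O).
have -> : f = kl_map (shuf_weil (scalars R) O) ∘ (g ∘ f).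
  by rewrite mcompA kg mcomp1m.
by eexists; eexists => H s x px; rewrite app_kl_map.
Qed.

Lemma poly_natural O G (a0 : mor G R) a :
  natural O (fun H => poly O a0 a (H := H)).
Proof.
move=> H s x H' t px; rewrite mcomp_addr mcomp_sumr compA; congr (_ + _).
by apply: eq_bigr => w _; rewrite mcomp_mulr compA.
Qed.

(** This is the injectivity half of the Kock-Lawvere axiom. *)
Lemma poly_inj O G (a0 b0 : mor G R) a b :
  (forall H (s : mor H G) x, is_pt O x -> poly O a0 a s x = poly O b0 b s x) ->
  a0 = b0 /\ {in words O, a =1 b}.
Proof.
move=> ab; have [g [gk _]] := KL (shuf_weil (scalars R) O).
pose c (a0 : mor G R) a : mor G (R × powo R (size (words O))) :=
  ⟨a0, tuple_of (fun i : 'I_(size (words O)) => a (word O i))⟩.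
have cE a0' a' H (s : mor H G) x : is_pt O x ->
    val_at (kl_map (shuf_weil (scalars R) O) ∘ c a0' a') s x = poly O a0' a' s x.
  move=> px; rewrite app_kl_map // /poly pr1_pair pr2_pair; congr (_ + _).
  rewrite 2!(sum_words O (fun w => _ * x w)); apply: eq_bigr => i _.
  by rewrite /word index_uniq ?words_uniq // valK coord_tuple.
have cab : c a0 a = c b0 b.
  rewrite -[LHS]mcomp1m -[RHS]mcomp1m -gk !compA; congr (_ ∘ _).
  by apply: map_ext => H s x px; rewrite !cE // ab.
split=> [|w /word_index[i ->]]; first by have := congr1 (mcomp pr1) cab; rewrite !pr1_pair.
by have := congr1 (fun p => coordm R i ∘ (pr2 ∘ p)) cab; rewrite !pr2_pair !coord_tuple.
Qed.

End KockLawvere.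

End Spectrum.

(** * Gluing along the cubes *)

Section Glue.
Context {E : universe} {R : ring_object E} {T : eqType}.
Implicit Types (G H X : E) (O : complex T).

Definition incl O' O : mor (shuf_spec R O') (shuf_spec R O) :=
  spec_pt O (coords (idm (shuf_spec R O'))).

Lemma incl_spec_pt O' O H (x : seq T -> mor H R) :
  {subset words O' <= words O} -> is_pt O' x ->
  incl O' O ∘ spec_pt O' x = spec_pt O x.
Proof.
move=> sub px; rewrite spec_ptS; last exact/(is_pt_mono sub)/coords_pt.
congr spec_pt; apply: funext => w.
by rewrite coordsS mcomp1m coords_spec_pt.
Qed.

Lemma val_at_incl O' O X G (k : mor G (shuf_spec R O ⇒ X)) H (s : mor H G) x :
  {subset words O' <= words O} -> is_pt O' x ->
  val_at (precomp X (incl O' O) ∘ k) s x = val_at k s x.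
Proof. by move=> sub px; rewrite /val_at app_precomp incl_spec_pt. Qed.

Lemma below_mono O u w : subseq u w -> {subset words (below O u) <= words (below O w)}.
Proof. by move=> uw v; rewrite !mem_below => /andP[vu ->]; rewrite (subseq_trans vu). Qed.

Lemma below_le O w : {subset words (below O w) <= words O}.
Proof. by move=> v; rewrite mem_below => /andP[]. Qed.

Section Cocone.
Variable O : complex T.

(** Index 0 is the empty word. Its cube is a point contained in all the others, which forces the
    polynomials on the cubes to share their constant term. *)
Definition vword (v : 'I_(size (words O)).+1) : seq T := nth [::] ([::] :: words O) v.

Lemma vword_in v : vword v \in [::] :: words O.
Proof. by apply: mem_nth; rewrite /= ltn_ord. Qed.

Lemma vword_exists w : w \in [::] :: words O -> exists v, w = vword v.
Proof.
rewrite -index_mem => lt_w; exists (Ordinal lt_w).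
by rewrite /vword nth_index // -index_mem.
Qed.

Definition sub_pair :=
  {p : 'I_(size (words O)).+1 * 'I_(size (words O)).+1 | subseq (vword p.1) (vword p.2)}.

Fact incl_below (e : sub_pair) :
  incl (below O (vword (val e).2)) O ∘
    incl (below O (vword (val e).1)) (below O (vword (val e).2)) =
  incl (below O (vword (val e).1)) O.
Proof.
have le2 := @below_le O (vword (val e).2); have le1 := @below_le O (vword (val e).1).
have le12 := below_mono (O := O) (valP e).
have p1 := coords_pt (idm (shuf_spec R (below O (vword (val e).1)))).
rewrite -[LHS]mcompm1 -[RHS]mcompm1 -[idm (shuf_spec R _)]spec_pt_coords compA.
by rewrite !incl_spec_pt //; apply: is_pt_mono p1.
Qed.

Definition words_cocone : inf_cocone R :=
  InfCocone (vert := 'I_(size (words O)).+1) (edge := sub_pair)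
    (src := fun e => (val e).1) (tgt := fun e => (val e).2)
    (node := fun v => shuf_weil (scalars R) (below O (vword v)))
    (arrow := fun e => incl (below O (vword (val e).1)) (below O (vword (val e).2)))
    (apex := shuf_weil (scalars R) O)
    (leg := fun v => incl (below O (vword v)) O)
    incl_below.

Hypothesis KL : kock_lawvere R.

(** The coefficient of a word [w] in the glued polynomial is the coefficient of
    [w] in the polynomial given on the cube indexed by [w] itself. *)
Lemma words_cocone_limit : turned_into_limit words_cocone R.
Proof.
move=> G f fE.
have /choice[ab fab] : forall v, exists ab : mor G R * (seq T -> mor G R),
    forall H (s : mor H G) x, is_pt (below O (vword v)) x ->
    val_at (f v) s x = poly (below O (vword v)) ab.1 ab.2 s x.
  by move=> v; have [a0 [a fa]] := poly_exists KL (f v); exists (a0, a).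
(* Compatibility along an edge becomes equality of coefficients on the smaller cube, because
   coefficients are unique. *)
have abE u v : subseq (vword u) (vword v) ->
    (ab v).1 = (ab u).1 /\ {in words (below O (vword u)), (ab v).2 =1 (ab u).2}.
  move=> uv; apply: (poly_inj KL) => H s x px; rewrite -fab //.
  have le_uv := below_mono (O := O) uv; have px' := is_pt_mono le_uv px.
  have := fE (exist _ (u, v) uv) => /= <-; rewrite val_at_incl // fab //.
  by rewrite /poly; congr (_ + _); symmetry; apply: sum_sub px.1.
have [v0 v0E] := vword_exists (mem_head [::] (words O)).
pose b w := if pselect (exists v, w = vword v) is left h
            then (ab (projT1 (cid h))).2 w else 0.
have bE v w : w \in words (below O (vword v)) -> b w = (ab v).2 w.
  rewrite mem_below => /andP[wv wO]; rewrite /b; case: pselect => [h|[]]; last first.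
    by apply: vword_exists; rewrite inE wO orbT.
  case: cid => u /= wu; symmetry; apply: (abE u v _).2; first by rewrite -wu.
  by rewrite mem_below -wu subseq_refl wO.
pose g : mor G (shuf_spec R O ⇒ R) := map_of O (fun H => poly O (ab v0).1 b (H := H)).
have gE H (s : mor H G) x : is_pt O x -> val_at g s x = poly O (ab v0).1 b s x.
  by move=> px; rewrite val_at_map_of //; apply: poly_natural.
exists g; split=> [v|g' g'E].
  apply: map_ext => H s x px; have le_v := @below_le O (vword v).
  have px' := is_pt_mono le_v px; rewrite val_at_incl // gE // fab //.
  rewrite /poly (abE v0 v _).1 -?v0E ?sub0seq //; congr (_ + _).
  rewrite (sum_sub _ _ (@below_le O (vword v)) px.1).
  by apply: eq_big_seq => w wv; rewrite (bE v).
(* Any other extension is again a polynomial, and its coefficients are read off cube by cube. *)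
have [b0 [b' g'b]] := poly_exists KL g'.
have b'E v : b0 = (ab v).1 /\ {in words (below O (vword v)), b' =1 (ab v).2}.
  have le_v := @below_le O (vword v).
  apply: (poly_inj KL) => H s x px; have px' := is_pt_mono le_v px.
  rewrite -fab // -g'E val_at_incl // g'b //.
  by rewrite /poly; congr (_ + _); symmetry; apply: sum_sub px.1.
apply: map_ext => H s x px; rewrite gE // g'b // /poly (b'E v0).1; congr (_ + _).
apply: eq_big_seq => w wO.
have [v wv] : exists v, w = vword v by apply: vword_exists; rewrite inE wO orbT.
have wv' : w \in words (below O (vword v)) by rewrite mem_below -wv subseq_refl.
by rewrite (bE v) // (b'E v).2.
Qed.

Context {X : E}.
Hypothesis mX : microlinear R X.

(** A compatible family is a cone over [words_cocone]; microlinearity carries the limit property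
    from [R] to [X]. *)
Lemma glue G (F : seq T -> family (T := T) R X G) :
  {in [::] :: words O, forall w, natural (below O w) (F w)} ->
  {in [::] :: words O &, forall u w, subseq u w ->
     forall H (s : mor H G) x, is_pt (below O u) x -> F w H s x = F u H s x} ->
  exists K : mor G (shuf_spec R O ⇒ X),
    {in [::] :: words O, forall w H (s : mor H G) x, is_pt (below O w) x ->
       val_at K s x = F w H s x}.
Proof.
move=> natF cF.
pose f (v : vert words_cocone) : mor G (Spec (node v) ⇒ X) :=
  map_of (below O (vword v)) (F (vword v)).
have fE v H (s : mor H G) x : is_pt (below O (vword v)) x ->
    val_at (f v) s x = F (vword v) H s x.
  by move=> px; rewrite val_at_map_of //; apply: natF; apply: vword_in.
have [|K [KE _]] := mX words_cocone_limit (f := f).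
  move=> e; apply: map_ext => H s x px /=.
  have sube := below_mono (O := O) (valP e).
  rewrite val_at_incl // !fE //; last exact: is_pt_mono px.
  by apply: cF; rewrite ?vword_in //; apply: (valP e).
exists K => w /vword_exists[v ->] H s x px.
by rewrite -fE // -KE val_at_incl //; apply: below_le.
Qed.

Lemma glue_uniq G (K K' : mor G (shuf_spec R O ⇒ X)) :
  {in [::] :: words O, forall w H (s : mor H G) x, is_pt (below O w) x ->
     val_at K s x = val_at K' s x} -> K = K'.
Proof.
move=> KK'; pose f (v : vert words_cocone) : mor G (Spec (node v) ⇒ X) :=
  precomp X (leg v) ∘ K.
have [|g [_ gU]] := mX words_cocone_limit (f := f).
  move=> e; apply: map_ext => H s x px /=.
  have sube := below_mono (O := O) (valP e).
  have [le1 le2] := (@below_le O (vword (val e).1), @below_le O (vword (val e).2)).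
  by rewrite !val_at_incl //; apply: is_pt_mono px.
rewrite -(gU K) // -(gU K') // => v; apply: map_ext => H s x px /=.
have le_v := @below_le O (vword v).
by rewrite !val_at_incl // (KK' _ (vword_in v)).
Qed.

End Cocone.
End Glue.

(** * Microlinearity of exponentials *)

Section Exponential.
Context {E : universe} (R : ring_object E).
Implicit Types G H X Y S : E.

Definition flip G S Y X (k : mor G (S ⇒ (Y ⇒ X))) : mor (G × Y) (S ⇒ X) :=
  currym (appm (appm (k ∘ (pr1 ∘ pr1)) pr2) (pr2 ∘ pr1)).

Definition unflip G S Y X (k : mor (G × Y) (S ⇒ X)) : mor G (S ⇒ (Y ⇒ X)) :=
  currym (currym (appm (k ∘ ⟨pr1 ∘ pr1, pr2⟩) (pr2 ∘ pr1))).

Lemma app_flip G S Y X (k : mor G (S ⇒ (Y ⇒ X))) H (s : mor H (G × Y)) p :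
  appm (flip k ∘ s) p = appm (appm (k ∘ (pr1 ∘ s)) p) (pr2 ∘ s).
Proof. by rewrite app_curry !appmS !compE. Qed.

Lemma app_unflip G S Y X (k : mor (G × Y) (S ⇒ X)) H (s : mor H G) p y :
  appm (appm (unflip k ∘ s) p) y = appm (k ∘ ⟨s, y⟩) p.
Proof. by rewrite app_curry app_curry appmS !compE. Qed.

Lemma flip_ext G S Y X (k k' : mor G (S ⇒ (Y ⇒ X))) : flip k = flip k' -> k = k'.
Proof.
move=> kk'; apply: expo_ext => H s p; apply: expo_ext => H' t y.
have := congr1 (fun f => appm (f ∘ ⟨s ∘ t, y⟩) (p ∘ t)) kk'.
by rewrite !app_flip pr1_pair pr2_pair !appmS !compA.
Qed.

(** A map to [Y ⇒ X] at stage [G] is a map to [X] at stage [G × Y], and the limit property is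
    required at every stage. *)
Lemma microlinear_exp X Y : microlinear R X -> microlinear R (Y ⇒ X).
Proof.
move=> mX c cR G f fE.
have flip_precomp S S' (u : mor S' S) (k : mor G (S ⇒ (Y ⇒ X))) :
    flip (precomp _ u ∘ k) = precomp X u ∘ flip k.
  by apply: expo_ext => H s p; rewrite app_precomp !app_flip app_precomp.
have [e|g [gE gU]] := mX c cR _ (fun v => flip (f v)).
  by rewrite -flip_precomp fE.
have unflipK : flip (unflip g) = g.
  by apply: expo_ext => H s p; rewrite app_flip app_unflip pair_eta.
exists (unflip g); split=> [v|g' g'E].
  by apply: flip_ext; rewrite flip_precomp unflipK.
by apply: flip_ext; rewrite unflipK; apply: gU => v; rewrite -flip_precomp g'E.
Qed.

Lemma microlinear_dist X Y : microlinear R X -> microlinear R (dist X Y).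
Proof. exact: microlinear_exp. Qed.

End Exponential.

(** * Explicit points given by lists of values *)

Section ValueLists.
Context {T : eqType} {K : comPzRingType}.
Implicit Types (O : complex T) (s : seq K).

Definition lookup O s (w : seq T) : K := nth 0 s (index w (words O)).

Definition shuf_table O : seq (nat * nat * seq nat) :=
  let n := size (words O) in
  [seq (i, j, [seq l <- iota 0 n | shuf (word O i) (word O j) (word O l)])
     | i <- iota 0 n, j <- iota 0 n].

Definition satisfies s (e : nat * nat * seq nat) : Prop :=
  nth 0 s e.1.1 * nth 0 s e.1.2 = foldr (fun l a => nth 0 s l + a) 0 e.2.

(** The conjunction over the table unfolds, for a concrete complex, to one ring identity for each
    pair of words, which [ring] can decide. *)
Lemma is_pt_lookup O s : size s = size (words O) ->
  foldr (fun e => and (satisfies s e)) True (shuf_table O) -> is_pt O (lookup O s).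
Proof.
move=> szs check; have {}check e : e \in shuf_table O -> satisfies s e.
  by elim: (shuf_table O) check => //= e' t IH [e's /IH ets]; rewrite inE => /predU1P[->|].
split=> [w wO|u v uO vO].
  by rewrite /lookup memNindex // nth_default ?szs.
have := check (index u (words O), index v (words O), _) (allpairs_f _ _ _).
rewrite !mem_iota !add0n !index_mem uO vO => /(_ isT isT).
rewrite /satisfies /= /word !nth_index // /lookup => ->.
rewrite -[foldr _ _ _](foldr_map (fun l => nth 0 s l) +%R 0).
rewrite foldrE big_map big_filter [RHS](big_nth [::]) /index_iota subn0.
rewrite big_seq_cond [RHS]big_seq_cond; apply: eq_big => // i.
rewrite mem_iota /= add0n => /andP[iO _].
by rewrite index_uniq ?words_uniq.
Qed.

End ValueLists.

Fixpoint subwords (T : eqType) (w : seq T) : seq (seq T) :=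
  if w is a :: w' then subwords w' ++ [seq a :: u | u <- subwords w'] else [:: [::]].

Lemma mem_subwords (T : eqType) (u w : seq T) : subseq u w -> u \in subwords w.
Proof.
elim: w u => [|a w IH] [|b u] //=; rewrite mem_cat.
  by rewrite IH ?sub0seq.
case: eqP => [->|_] uw; last by rewrite IH.
by rewrite map_f ?orbT // IH.
Qed.

Definition closed_list (T : eqType) (L : seq (seq T)) : bool :=
  all (fun w => all (fun u => (u == [::]) || (u \in L)) (subwords w)) L.

Lemma closed_listP (T : eqType) (L : seq (seq T)) : closed_list L ->
  forall u w, w \in L -> subseq u w -> u != [::] -> u \in L.
Proof.
move=> /allP closedL u w /closedL /allP wL /mem_subwords /wL.
by case/orP => // /eqP ->.
Qed.

(** The order of the words in these lists is the order of the values in every explicit point below.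
    In [words_D2] the absence of two-letter words makes the product of the two coordinates 0. *)
Definition words_D2 : seq (seq nat) := [:: [:: 0]; [:: 1]]%N.
Definition words_D3e : seq (seq nat) := [:: [:: 0]; [:: 1]; [:: 0; 1]; [:: 1; 0]]%N.
Definition words3 : seq (seq nat) :=
  [:: [:: 0]; [:: 1]; [:: 2];
      [:: 0; 1]; [:: 1; 0]; [:: 0; 2]; [:: 2; 0]; [:: 1; 2]; [:: 2; 1];
      [:: 0; 1; 2]; [:: 0; 2; 1]; [:: 1; 0; 2]; [:: 1; 2; 0]; [:: 2; 0; 1];
      [:: 2; 1; 0]]%N.

Definition cD2 : complex nat :=
  Complex (words := words_D2) isT isT (@closed_listP _ words_D2 isT).
Definition cD3e : complex nat :=
  Complex (words := words_D3e) isT isT (@closed_listP _ words_D3e isT).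
Definition c3 : complex nat :=
  Complex (words := words3) isT isT (@closed_listP _ words3 isT).

Definition table_D2 := Eval vm_compute in shuf_table cD2.
Definition table_D3e := Eval vm_compute in shuf_table cD3e.
Definition table3 := Eval vm_compute in shuf_table c3.

Lemma is_pt_D2 (K : comPzRingType) (x : seq K) : size x = 2%N ->
  foldr (fun e => and (satisfies x e)) True table_D2 -> is_pt cD2 (lookup cD2 x).
Proof.
move=> sx; rewrite (_ : table_D2 = shuf_table cD2).
  exact: is_pt_lookup.
by vm_cast_no_check (erefl table_D2).
Qed.
Lemma is_pt_D3e (K : comPzRingType) (x : seq K) : size x = 4%N ->
  foldr (fun e => and (satisfies x e)) True table_D3e -> is_pt cD3e (lookup cD3e x).
Proof.
move=> sx; rewrite (_ : table_D3e = shuf_table cD3e).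
  exact: is_pt_lookup.
by vm_cast_no_check (erefl table_D3e).
Qed.
Lemma is_pt3 (K : comPzRingType) (x : seq K) : size x = 15%N ->
  foldr (fun e => and (satisfies x e)) True table3 -> is_pt c3 (lookup c3 x).
Proof.
move=> sx; rewrite (_ : table3 = shuf_table c3).
  exact: is_pt_lookup.
by vm_cast_no_check (erefl table3).
Qed.

(* [ring] can miss hypotheses on monomials whose variables are not adjacent in
   its order, which is their order of appearance: hence the variants. *)
Ltac nil_ring aa bb cc ac bc dd :=
  repeat split; rewrite ?(mulr0, mul0r, addr0, oppr0) //;
  first [ring: aa bb cc ac bc dd | ring: dd ac aa cc bb bc
        | ring: dd bc cc ac aa bb | ring: ac dd aa].

Section D3ePoints.
Context {K : comPzRingType}.
Variables a b c : K.
Hypotheses (aa : a * a = 0) (bb : b * b = 0) (cc : c * c = 0).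
Hypotheses (ac : a * c = 0) (bc : b * c = 0).

(** The product of the two letters is the sum of the values at 01 and 10, which forces
    [a * b - c]. *)
Lemma D3e_pt : is_pt cD3e (lookup cD3e [:: a; b; a * b - c; c]).
Proof.
apply: is_pt_D3e => //; rewrite /table_D3e /satisfies /=.
nil_ring aa bb cc ac bc aa.
Qed.

(* The points of [c3] are the group-like noncommutative polynomials in
   the letters X = 0, Y = 1 and Z = 2; this one is
   (1 + d X) (1 + a Y + b Z + (ab - c) YZ + c ZY), and [right_pt] has the factors
   in the other order. *)
Lemma left_pt (d : K) : d * d = 0 ->
  is_pt c3 (lookup c3 [:: d; a; b; d * a; 0; d * b; 0; a * b - c; c;
                         d * (a * b - c); d * c; 0; 0; 0; 0]).
Proof.
move=> dd; apply: is_pt3 => //; rewrite /table3 /satisfies /=.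
nil_ring aa bb cc ac bc dd.
Qed.

Lemma right_pt (d : K) : d * d = 0 ->
  is_pt c3 (lookup c3 [:: d; a; b; 0; d * a; 0; d * b; a * b - c; c;
                         0; 0; 0; d * (a * b - c); 0; d * c]).
Proof.
move=> dd; apply: is_pt3 => //; rewrite /table3 /satisfies /=.
nil_ring aa bb cc ac bc dd.
Qed.

(* 1 + a X + b (ZY - YZ) + (ab - c) X (ZY - YZ) + c (ZY - YZ) X *)
Lemma bracket_pt :
  is_pt c3 (lookup c3 [:: a; 0; 0; 0; 0; 0; 0; - b; b;
                         - (a * b - c); a * b - c; 0; - c; 0; c]).
Proof.
apply: is_pt3 => //; rewrite /table3 /satisfies /=.
nil_ring aa bb cc ac bc aa.
Qed.

End D3ePoints.

Section D2Points.
Context {K : comPzRingType}.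
Variables a b : K.
Hypotheses (aa : a * a = 0) (bb : b * b = 0) (ab : a * b = 0).

Lemma D2_pt : is_pt cD2 (lookup cD2 [:: a; b]).
Proof.
apply: is_pt_D2 => //; rewrite /table_D2 /satisfies /=.
by repeat split; ring: aa bb ab.
Qed.

(* 1 + a [X, [Y, Z]] + b [Y, [Z, X]] *)
Lemma bracket_sum_pt :
  is_pt c3 (lookup c3 [:: 0; 0; 0; 0; 0; 0; 0; 0; 0; a; b - a; - b; b - a; - b; a]).
Proof.
apply: is_pt3 => //; rewrite /table3 /satisfies /=.
nil_ring aa bb ab aa aa aa.
Qed.

(* 1 + a ([X, [Y, Z]] + [Y, [Z, X]]) + b [Z, [X, Y]] *)
Lemma bracket_opp_pt :
  is_pt c3 (lookup c3 [:: 0; 0; 0; 0; 0; 0; 0; 0; 0; a - b; 0; b - a; 0; b - a; a - b]).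
Proof.
apply: is_pt3 => //; rewrite /table3 /satisfies /=.
nil_ring aa bb ab aa aa aa.
Qed.

End D2Points.

(** * Strong differences and sums of tangent vectors *)

(** The list [L] of shuffles is a parameter, so that it can be written out and checked by
    computation. *)
Lemma pt_mul (T : eqType) (K : comPzRingType) (O : complex T) (x : seq T -> K) u v L :
  is_pt O x -> u \in words O -> v \in words O ->
  [seq w <- words O | shuf u v w] = L ->
  x u * x v = foldr (fun w a => x w + a) 0 L.
Proof.
case=> _ xM uO vO <-; rewrite xM // -big_filter -(foldr_map x +%R 0).
by rewrite foldrE big_map.
Qed.

(** A converse of [is_pt_mono], used to show that an explicit point lies on a single cube. *)
Lemma is_pt_sub (T : eqType) (K : comPzRingType) (O O' : complex T) (x : seq T -> K) :
  {subset words O' <= words O} -> is_pt O x -> (forall w, w \notin words O' -> x w = 0) ->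
  is_pt O' x.
Proof.
move=> sub [_ xM] x0; split=> // u v uO' vO'; rewrite xM ?sub //.
have := sum_sub (shuf u v) (fun=> 1) sub x0.
by under eq_bigr do rewrite mul1r; under [RHS]eq_bigr do rewrite mul1r.
Qed.

Section D.
Context {E : universe} (R : ring_object E).
Implicit Types G H X : E.

Lemma lookupS (T : eqType) (O : complex T) G H (l : seq (mor G R)) (s : mor H G) w :
  lookup O l w ∘ s = lookup O [seq f ∘ s | f <- l] w.
Proof.
rewrite /lookup; case: (ltnP (index w (words O)) (size l)) => [lt|ge].
  by rewrite (nth_map 0).
by rewrite !nth_default ?size_map // mcomp_0r.
Qed.

Lemma mcomp_subr G H (x y : mor G R) (s : mor H G) : (x - y) ∘ s = x ∘ s - y ∘ s.
Proof. by rewrite mcomp_addr mcomp_oppr. Qed.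

Lemma D_eq H (d d' : mor H (D R)) : valD d = valD d' -> d = d'.
Proof. exact: eqz_mono. Qed.

Lemma valDS G H (d : mor G (D R)) (s : mor H G) : valD d ∘ s = valD (d ∘ s).
Proof. exact: compA. Qed.

(** The default value is only there to make the map total. *)
Definition to_D H (r : mor H R) : mor H (D R) :=
  if pselect (r * r = 0) is left r2 then inD r2 else zeroD R H.

Lemma valD_to_D H (r : mor H R) : r * r = 0 -> valD (to_D r) = r.
Proof. by rewrite /to_D; case: pselect => // r2 _; rewrite valD_inD. Qed.

Lemma to_D_val H (d : mor H (D R)) : to_D (valD d) = d.
Proof. by apply: D_eq; rewrite valD_to_D ?valD_sqr. Qed.

Lemma to_DS G H (r : mor G R) (s : mor H G) : r * r = 0 -> to_D r ∘ s = to_D (r ∘ s).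
Proof.
move=> r2; apply: D_eq; rewrite -valDS !valD_to_D //.
by rewrite -mcomp_mulr r2 mcomp_0r.
Qed.

Lemma to_D0 H : to_D (0 : mor H R) = zeroD R H.
Proof. by apply: D_eq; rewrite valD_zero valD_to_D ?mulr0. Qed.

Lemma zeroDS G H (s : mor H G) : zeroD R G ∘ s = zeroD R H.
Proof. by apply: D_eq; rewrite -valDS !valD_zero mcomp_0r. Qed.

Definition D3e1 H (p : mor H (D3e R)) : mor H (D R) := pr1 ∘ (pr1 ∘ (eqz_incl ∘ p)).
Definition D3e2 H (p : mor H (D3e R)) : mor H (D R) := pr2 ∘ (pr1 ∘ (eqz_incl ∘ p)).
Definition D3e3 H (p : mor H (D3e R)) : mor H (D R) := pr2 ∘ (eqz_incl ∘ p).

Lemma D3e_eq H (p q : mor H (D3e R)) :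
  D3e1 p = D3e1 q -> D3e2 p = D3e2 q -> D3e3 p = D3e3 q -> p = q.
Proof.
move=> e1 e2 e3; apply: eqz_mono.
by rewrite -[LHS]pair_eta -[RHS]pair_eta; congr pairm => //;
  rewrite -[LHS]pair_eta -[RHS]pair_eta; congr pairm.
Qed.

Lemma D3e_rel H (p : mor H (D3e R)) :
  valD (D3e1 p) * valD (D3e3 p) = 0 /\ valD (D3e2 p) * valD (D3e3 p) = 0.
Proof.
have := congr1 (fun f => f ∘ p) (eqz_eq
  (⟨valD (pr1 ∘ pr1) * valD pr2, valD (pr2 ∘ pr1) * valD pr2⟩
     : mor (D R × D R × D R) (R × R)) ⟨0, 0⟩).
rewrite /= !mcomp_pair !mcomp_mulr !mcomp_0r !valDS !compA => e.
have := congr1 (mcomp pr1) e; have := congr1 (mcomp pr2) e.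
by rewrite !pr1_pair !pr2_pair.
Qed.

Lemma D3eE H (d1 d2 e : mor H (D R)) (h1 : valD d1 * valD e = 0)
    (h2 : valD d2 * valD e = 0) :
  [/\ D3e1 (inD3e h1 h2) = d1, D3e2 (inD3e h1 h2) = d2 & D3e3 (inD3e h1 h2) = e].
Proof. by rewrite /D3e1 /D3e2 /D3e3 eqz_factK !pr1_pair !pr2_pair. Qed.

Definition of_D3e : mor (D3e R) (shuf_spec R cD3e) :=
  let p := idm (D3e R) in
  let a := valD (D3e1 p) in let b := valD (D3e2 p) in let c := valD (D3e3 p) in
  spec_pt cD3e (lookup cD3e [:: a; b; a * b - c; c]).

Lemma of_D3eE H (p : mor H (D3e R)) :
  let a := valD (D3e1 p) in let b := valD (D3e2 p) in let c := valD (D3e3 p) in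
  is_pt cD3e (lookup cD3e [:: a; b; a * b - c; c]) /\
  of_D3e ∘ p = spec_pt cD3e (lookup cD3e [:: a; b; a * b - c; c]).
Proof.
have pt H' (q : mor H' (D3e R)) : is_pt cD3e (lookup cD3e
    [:: valD (D3e1 q); valD (D3e2 q); valD (D3e1 q) * valD (D3e2 q) - valD (D3e3 q);
        valD (D3e3 q)]).
  by have [h1 h2] := D3e_rel q; apply: D3e_pt; rewrite ?valD_sqr.
split=> //; rewrite spec_ptS //; congr spec_pt; apply: funext => w.
by rewrite lookupS /= mcomp_subr mcomp_mulr !valDS !compA mcomp1m.
Qed.

Lemma D3e_coords H (p : mor H (shuf_spec R cD3e)) :
  let y := coords p in
  [/\ y [:: 0]%N * y [:: 0]%N = 0, y [:: 1]%N * y [:: 1]%N = 0,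
      y [:: 1; 0]%N * y [:: 1; 0]%N = 0,
      y [:: 0]%N * y [:: 1; 0]%N = 0 & y [:: 1]%N * y [:: 1; 0]%N = 0].
Proof. by split; rewrite (pt_mul (coords_pt p) (L := [::])). Qed.

Definition to_D3e : mor (shuf_spec R cD3e) (D3e R) :=
  let: And5 h0 h1 h10 h0_10 h1_10 := D3e_coords (idm (shuf_spec R cD3e)) in
  eqz_fact ⟨⟨inD h0, inD h1⟩, inD h10⟩
    (inD3e_subproof (d1 := inD h0) (d2 := inD h1) (e := inD h10)
       (etrans (congr2 *%R (valD_inD h0) (valD_inD h10)) h0_10)
       (etrans (congr2 *%R (valD_inD h1) (valD_inD h10)) h1_10)).

Lemma to_D3eE H (y : seq nat -> mor H R) : is_pt cD3e y ->
  let p := to_D3e ∘ spec_pt cD3e y in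
  [/\ valD (D3e1 p) = y [:: 0]%N, valD (D3e2 p) = y [:: 1]%N &
      valD (D3e3 p) = y [:: 1; 0]%N].
Proof.
move=> py; rewrite /D3e1 /D3e2 /D3e3 /to_D3e.
case: (D3e_coords _) => h0 h1 h10 h0_10 h1_10.
rewrite [eqz_incl ∘ _]mcompA eqz_factK !compE -!valDS !valD_inD.
by rewrite !coordsS mcomp1m coords_spec_pt.
Qed.

(** Every point of [D3e] is thus the image of a point of the spectrum, so maps out of [D3e] are
    determined by their restriction along [to_D3e]. *)
Lemma of_to_D3e H (p : mor H (D3e R)) : to_D3e ∘ (of_D3e ∘ p) = p.
Proof.
have [pt ->] := of_D3eE p; have [e1 e2 e3] := to_D3eE pt.
by apply: D3e_eq; apply: D_eq; rewrite ?e1 ?e2 ?e3.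
Qed.

End D.

Section Evaluation.
Context {E : universe} {R : ring_object E} {X : E}.
Hypotheses (KL : kock_lawvere R) (mX : microlinear R X).
Implicit Types G H : E.

Lemma inD3eS G H (d1 d2 e : mor G (D R)) (h1 : valD d1 * valD e = 0)
    (h2 : valD d2 * valD e = 0) (s : mor H G) (p : mor H (D3e R)) :
  d1 ∘ s = D3e1 p -> d2 ∘ s = D3e2 p -> e ∘ s = D3e3 p -> inD3e h1 h2 ∘ s = p.
Proof.
have [e1 e2 e3] := D3eE h1 h2 => p1 p2 p3.
by apply: D3e_eq; rewrite -?p1 -?p2 -?p3 -?[in RHS]e1 -?[in RHS]e2 -?[in RHS]e3
  /D3e1 /D3e2 /D3e3 !compA.
Qed.

Definition word01 : seq nat := [:: 0; 1]%N.
Definition word10 : seq nat := [:: 1; 0]%N.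

(** Every word of [cD3e] is a subword of 01 or of 10, so agreement on these two squares is agreement
    on all the cubes, and gluing is unique. *)
Lemma D3e_family_eq G (L L' : family (T := nat) R X G) :
  natural cD3e L -> natural cD3e L' ->
  (forall H (s : mor H G) y, is_pt (below cD3e word01) y -> L H s y = L' H s y) ->
  (forall H (s : mor H G) y, is_pt (below cD3e word10) y -> L H s y = L' H s y) ->
  forall H (s : mor H G) y, is_pt cD3e y -> L H s y = L' H s y.
Proof.
move=> natL natL' L01 L10 H s y py.
rewrite -(val_at_map_of s natL) // -(val_at_map_of s natL') //.
congr val_at; apply: (glue_uniq KL mX) => w wO H' t z pz.
have pz' := is_pt_mono (@below_le _ _ _) pz; rewrite !val_at_map_of //.
have [w01|w10] : subseq w word01 \/ subseq w word10.
- by move: wO; rewrite !inE => /or4P[||/eqP->|/orP[]/eqP->];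
    do ?[move/eqP->]; [left|left|left|left|right].
- by apply: L01; apply: is_pt_mono (below_mono w01) pz.
by apply: L10; apply: is_pt_mono (below_mono w10) pz.
Qed.

Section StrongDifference.
Context {G : E} (g1 g2 : mor G (D R × D R ⇒ X)) (L : family (T := nat) R X G).
Hypothesis natL : natural cD3e L.
Hypothesis L01 : forall H (s : mor H G) y, is_pt (below cD3e word01) y ->
  L s y = appm (g2 ∘ s) ⟨to_D (y [:: 0%N]), to_D (y [:: 1%N])⟩.
Hypothesis L10 : forall H (s : mor H G) y, is_pt (below cD3e word10) y ->
  L s y = appm (g1 ∘ s) ⟨to_D (y [:: 0%N]), to_D (y [:: 1%N])⟩.

(** On the square of 01 the value at 10, which is the coordinate [e] of [D3e], vanishes. *)
Lemma floorD3eE H (y : seq nat -> mor H R) : is_pt (below cD3e word01) y ->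
  to_D3e R ∘ spec_pt cD3e y = floorD3e (to_D (y [:: 0%N])) (to_D (y [:: 1%N])).
Proof.
move=> py; have py' := is_pt_mono (@below_le _ _ _) py.
have [e1 e2 e3] := to_D3eE py'; rewrite /floorD3e.
set h1 := axis1_subproof _; set h2 := axis1_subproof _.
have [f1 f2 f3] := D3eE h1 h2.
apply: D3e_eq; apply: D_eq; rewrite ?f1 ?f2 ?f3 ?valD_to_D ?(is_pt_sq _ py) //.
by rewrite e3 valD_zero py.1.
Qed.

(** On the square of 10 the product of the two letters has the single term 10, so [e] is [d1 d2]. *)
Lemma mulD3eE H (y : seq nat -> mor H R) : is_pt (below cD3e word10) y ->
  to_D3e R ∘ spec_pt cD3e y = mulD3e (to_D (y [:: 0%N])) (to_D (y [:: 1%N])).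
Proof.
move=> py; have py' := is_pt_mono (@below_le _ _ _) py.
have [e1 e2 e3] := to_D3eE py'; rewrite /mulD3e.
set h1 := mulDl_subproof _ _; set h2 := mulDr_subproof _ _.
have [f1 f2 f3] := D3eE h1 h2.
apply: D3e_eq; apply: D_eq; rewrite ?f1 ?f2 ?f3 ?valD_to_D ?(is_pt_sq _ py) //.
rewrite e3 /mulD valD_inD !valD_to_D ?(is_pt_sq _ py) //.
by rewrite (pt_mul (L := [:: word10]) py) //= addr0.
Qed.

Lemma diff_map_unique k : is_diff_map g1 g2 k ->
  precomp X (to_D3e R) ∘ k = map_of cD3e L.
Proof.
move=> kg; apply: map_ext => H s y py; rewrite val_at_map_of //.
apply: (D3e_family_eq (val_at_natural _) natL) => // {py} {}H {}s {}y py.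
  have py' := is_pt_mono (@below_le _ _ _) py.
  rewrite /val_at app_precomp floorD3eE // L01 //.
  by case: (kg H s (to_D (y [:: 0%N])) (to_D (y [:: 1%N]))).
have py' := is_pt_mono (@below_le _ _ _) py.
rewrite /val_at app_precomp mulD3eE // L10 //.
by case: (kg H s (to_D (y [:: 0%N])) (to_D (y [:: 1%N]))).
Qed.

Lemma diff_map_exists : is_diff_map g1 g2 (precomp X (of_D3e R) ∘ map_of cD3e L).
Proof.
move=> H s d1 d2; split; rewrite app_precomp.
  have [/= pt ->] := of_D3eE (floorD3e d1 d2); move: pt; rewrite /floorD3e.
  set h1 := axis1_subproof _; set h2 := axis1_subproof _.
  have [-> -> ->] := D3eE h1 h2; rewrite valD_zero => pt.
  rewrite -/(val_at _ s _) val_at_map_of // L01; last first.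
    apply: (is_pt_sub _ pt); first exact: below_le.
    move=> w; have [wO|/pt.1 //] := boolP (w \in words cD3e).
    by move: wO; rewrite !inE => /or4P[] /eqP ->.
  by rewrite /lookup /= !to_D_val.
have [/= pt ->] := of_D3eE (mulD3e d1 d2); move: pt; rewrite /mulD3e.
set h1 := mulDl_subproof _ _; set h2 := mulDr_subproof _ _.
have [-> -> ->] := D3eE h1 h2; rewrite /mulD valD_inD => pt.
rewrite -/(val_at _ s _) val_at_map_of // L10; last first.
  apply: (is_pt_sub _ pt); first exact: below_le.
  move=> w; have [wO|/pt.1 //] := boolP (w \in words cD3e).
  by move: wO; rewrite !inE => /or4P[] /eqP -> //; rewrite /lookup /= subrr.
by rewrite /lookup /= !to_D_val.
Qed.

(** A family [L] that restricts to [g2] on the square of 01 and to [g1] on that of 10 is the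
    difference map read on the spectrum. The point [(0, 0, e)] has the values [0, 0, - e, e]
    there. *)
Lemma strong_diff_eval H (s : mor H G) (e : mor H (D R)) :
  appm (strong_diff g1 g2 ∘ s) e = L s (lookup cD3e [:: 0; 0; - valD e; valD e]).
Proof.
(* A difference map exists, so [xget] does not return its default value. *)
have kg : is_diff_map g1 g2 (diff_map g1 g2).
  by rewrite /diff_map; case: xgetP => [k _ //|no]; case: (no _ diff_map_exists).
have axis : axisD3e pr2 ∘ ⟨s, e⟩ = axisD3e e.
  rewrite {1}/axisD3e; have [e1 e2 e3] := D3eE (axis2_subproof e) (axis2_subproof e).
  by apply: inD3eS; rewrite ?e1 ?e2 ?e3 ?zeroDS ?pr2_pair.
rewrite app_lam appmS weakenE axis -[axisD3e e]of_to_D3e -app_precomp.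
rewrite diff_map_unique //; have [/= pt ->] := of_D3eE (axisD3e e); move: pt.
rewrite /axisD3e; set h1 := axis2_subproof _; have [-> -> ->] := D3eE h1 h1.
by rewrite valD_zero mul0r sub0r => pt; rewrite -/(val_at _ s _) val_at_map_of.
Qed.

End StrongDifference.

End Evaluation.

Section Addition.
Context {E : universe} {R : ring_object E} {X : E}.
Implicit Types G H : E.

Definition D21 H (p : mor H (D2 R)) : mor H (D R) := pr1 ∘ (eqz_incl ∘ p).
Definition D22 H (p : mor H (D2 R)) : mor H (D R) := pr2 ∘ (eqz_incl ∘ p).

Lemma D21S G H (p : mor G (D2 R)) (s : mor H G) : D21 p ∘ s = D21 (p ∘ s).
Proof. by rewrite /D21 !compA. Qed.

Lemma D22S G H (p : mor G (D2 R)) (s : mor H G) : D22 p ∘ s = D22 (p ∘ s).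
Proof. by rewrite /D22 !compA. Qed.

Lemma D2_eq H (p q : mor H (D2 R)) : D21 p = D21 q -> D22 p = D22 q -> p = q.
Proof.
move=> e1 e2; apply: eqz_mono.
by rewrite -[LHS]pair_eta -[RHS]pair_eta; congr pairm.
Qed.

Lemma D2_rel H (p : mor H (D2 R)) : valD (D21 p) * valD (D22 p) = 0.
Proof.
have := congr1 (fun f => f ∘ p) (eqz_eq (valD pr1 * valD pr2 : mor (D R × D R) R) 0).
by rewrite /= !mcomp_mulr !mcomp_0r !valDS !compA.
Qed.

Lemma D2E H (d1 d2 : mor H (D R)) (h : valD d1 * valD d2 = 0) :
  D21 (inD2 h) = d1 /\ D22 (inD2 h) = d2.
Proof. by rewrite /D21 /D22 eqz_factK !pr1_pair !pr2_pair. Qed.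

Definition of_D2 : mor (D2 R) (shuf_spec R cD2) :=
  let p := idm (D2 R) in spec_pt cD2 (lookup cD2 [:: valD (D21 p); valD (D22 p)]).

Lemma of_D2E H (p : mor H (D2 R)) :
  is_pt cD2 (lookup cD2 [:: valD (D21 p); valD (D22 p)]) /\
  of_D2 ∘ p = spec_pt cD2 (lookup cD2 [:: valD (D21 p); valD (D22 p)]).
Proof.
have pt H' (q : mor H' (D2 R)) : is_pt cD2 (lookup cD2 [:: valD (D21 q); valD (D22 q)]).
  by apply: D2_pt; rewrite ?valD_sqr ?D2_rel.
split=> //; rewrite spec_ptS //; congr spec_pt; apply: funext => w.
by rewrite lookupS /= !valDS !compA mcomp1m.
Qed.

Lemma D2_coords H (p : mor H (shuf_spec R cD2)) :
  let y := coords p in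
  [/\ y [:: 0]%N * y [:: 0]%N = 0, y [:: 1]%N * y [:: 1]%N = 0 &
      y [:: 0]%N * y [:: 1]%N = 0].
Proof. by split; rewrite (pt_mul (coords_pt p) (L := [::])). Qed.

Definition to_D2 : mor (shuf_spec R cD2) (D2 R) :=
  let: And3 h0 h1 h01 := D2_coords (idm (shuf_spec R cD2)) in
  eqz_fact ⟨inD h0, inD h1⟩
    (inD2_subproof (d1 := inD h0) (d2 := inD h1)
       (etrans (congr2 *%R (valD_inD h0) (valD_inD h1)) h01)).

Lemma to_D2E H (y : seq nat -> mor H R) : is_pt cD2 y ->
  let p := to_D2 ∘ spec_pt cD2 y in
  valD (D21 p) = y [:: 0]%N /\ valD (D22 p) = y [:: 1]%N.
Proof.
move=> py; rewrite /D21 /D22 /to_D2.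
case: (D2_coords _) => h0 h1 h01.
rewrite [eqz_incl ∘ _]mcompA eqz_factK !compE -!valDS !valD_inD.
by rewrite !coordsS mcomp1m coords_spec_pt.
Qed.

Lemma of_to_D2 H (p : mor H (D2 R)) : to_D2 ∘ (of_D2 ∘ p) = p.
Proof.
have [pt ->] := of_D2E p; have [e1 e2] := to_D2E pt.
by apply: D2_eq; apply: D_eq; rewrite ?e1 ?e2.
Qed.

Hypotheses (KL : kock_lawvere R) (mX : microlinear R X).
Context {G : E} (t1 t2 : mor G (D R ⇒ X)) (L : family (T := nat) R X G).
Hypothesis natL : natural cD2 L.
Hypothesis L0 : forall H (s : mor H G) y, is_pt (below cD2 [:: 0%N]) y ->
  L s y = appm (t1 ∘ s) (to_D (y [:: 0%N])).
Hypothesis L1 : forall H (s : mor H G) y, is_pt (below cD2 [:: 1%N]) y ->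
  L s y = appm (t2 ∘ s) (to_D (y [:: 1%N])).

(** The cubes of [cD2] are the two axes and their common point, so a map is determined by its
    restrictions to the axes. *)
Lemma add_map_unique l : is_add_map t1 t2 l -> precomp X to_D2 ∘ l = map_of cD2 L.
Proof.
move=> lt; apply: (glue_uniq KL mX) => w wO H s y py.
have py' := is_pt_mono (@below_le _ _ _) py; have [e1 e2] := to_D2E py'.
rewrite val_at_map_of // /val_at app_precomp.
have [w0|w1] : subseq w [:: 0%N] \/ subseq w [:: 1%N].
- by move: wO; rewrite !inE => /or3P[] /eqP ->; [left|left|right].
- have py1 := is_pt_mono (below_mono w0) py.
  rewrite L0 //; case: (lt H s (to_D (y [:: 0%N]))) => <- _; congr appm.
  rewrite /axis1; set h := axis1_subproof _; have [f1 f2] := D2E h.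
  by apply: D2_eq; apply: D_eq; rewrite ?f1 ?f2 ?e1 ?e2 ?valD_zero
    ?valD_to_D ?(is_pt_sq _ py) // py1.1.
have py1 := is_pt_mono (below_mono w1) py.
rewrite L1 //; case: (lt H s (to_D (y [:: 1%N]))) => _ <-; congr appm.
rewrite /axis2; set h := axis2_subproof _; have [f1 f2] := D2E h.
by apply: D2_eq; apply: D_eq; rewrite ?f1 ?f2 ?e1 ?e2 ?valD_zero
  ?valD_to_D ?(is_pt_sq _ py) // py1.1.
Qed.

Lemma add_map_exists : is_add_map t1 t2 (precomp X of_D2 ∘ map_of cD2 L).
Proof.
move=> H s d; split; rewrite app_precomp.
  have [pt ->] := of_D2E (axis1 d); move: pt; rewrite /axis1.
  set h := axis1_subproof _; have [-> ->] := D2E h; rewrite valD_zero => pt.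
  rewrite -/(val_at _ s _) val_at_map_of // L0; last first.
    apply: (is_pt_sub _ pt); first exact: below_le.
    move=> w; have [wO|/pt.1 //] := boolP (w \in words cD2).
    by move: wO; rewrite !inE => /orP[] /eqP ->.
  by rewrite /lookup /= !to_D_val.
have [pt ->] := of_D2E (axis2 d); move: pt; rewrite /axis2.
set h := axis2_subproof _; have [-> ->] := D2E h; rewrite valD_zero => pt.
rewrite -/(val_at _ s _) val_at_map_of // L1; last first.
  apply: (is_pt_sub _ pt); first exact: below_le.
  move=> w; have [wO|/pt.1 //] := boolP (w \in words cD2).
  by move: wO; rewrite !inE => /orP[] /eqP ->.
by rewrite /lookup /= !to_D_val.
Qed.

(** A sum is computed from any natural family [L] extending both summands along the axes, by
    evaluating it on the diagonal. *)
Lemma add_tangent_eval H (s : mor H G) (d : mor H (D R)) :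
  appm (add_tangent t1 t2 ∘ s) d = L s (lookup cD2 [:: valD d; valD d]).
Proof.
have lt : is_add_map t1 t2 (add_map t1 t2).
  by rewrite /add_map; case: xgetP => [l _ //|no]; case: (no _ add_map_exists).
have [d1 d2] := D2E (valD_sqr d); rewrite -/(diagD2 d) in d1 d2.
have diag : diagD2 pr2 ∘ ⟨s, d⟩ = diagD2 d.
  have [e1 e2] := D2E (valD_sqr (pr2 : mor (G × D R) (D R))).
  rewrite -/(diagD2 _) in e1 e2.
  by apply: D2_eq; rewrite ?d1 ?d2 -?D21S -?D22S ?e1 ?e2 pr2_pair.
rewrite app_lam appmS weakenE diag -[diagD2 d]of_to_D2 -app_precomp.
rewrite add_map_unique //; have [pt ->] := of_D2E (diagD2 d).
by rewrite d1 d2 in pt *; rewrite -/(val_at _ s _) val_at_map_of.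
Qed.

End Addition.

(** * Distributions *)

Section Distributions.
Context {E : universe} {M : E}.
Implicit Types G H A B C : E.

(** Test functions are kept uncurried, with their parameters in the stage, so that iterated
    integrals are compared by composing substitutions. *)
Definition integral G A (f : mor G (dist M A)) (k : mor (G × A) M) : mor G M :=
  appm f (currym k).

Lemma integralS G A (f : mor G (dist M A)) k H (s : mor H G) :
  integral f k ∘ s = integral (f ∘ s) (k ∘ ⟨s ∘ pr1, pr2⟩).
Proof. by rewrite /integral appmS curryS. Qed.

Lemma curry_app G X Y (h : mor G (X ⇒ Y)) : currym (appm (h ∘ pr1) pr2) = h.
Proof. by rewrite [RHS]curry_uniq. Qed.

Lemma dist_ext G A (f g : mor G (dist M A)) :
  (forall H (s : mor H G) k, integral (f ∘ s) k = integral (g ∘ s) k) -> f = g.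
Proof.
move=> fg; apply: expo_ext => H s h.
by have := fg H s (appm (h ∘ pr1) pr2); rewrite /integral curry_app.
Qed.

Lemma integral_dirac G A (a : mor G A) H (s : mor H G) k :
  integral (dirac M a ∘ s) k = k ∘ ⟨idm H, a ∘ s⟩.
Proof.
rewrite /integral app_lam appmS !compE.
by rewrite -[currym k]mcompm1 app_curry.
Qed.

Lemma integral_push G A B (u : mor A B) (f : mor G (dist M A)) H (s : mor H G) k :
  integral (push u f ∘ s) k = integral (f ∘ s) (k ∘ ⟨pr1, u ∘ pr2⟩).
Proof.
rewrite /integral app_lam appmS weakenE; congr appm.
apply: expo_ext => H' s' a; rewrite compA app_lam appmS weakenE !compE.
by rewrite !app_curry !compE.
Qed.

Lemma integral_conv G A B (f : mor G (dist M A)) (g : mor G (dist M B))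
    H (s : mor H G) k :
  integral (conv f g ∘ s) k =
  integral (f ∘ s)
    (integral (g ∘ (s ∘ pr1)) (k ∘ ⟨pr1 ∘ pr1, ⟨pr2 ∘ pr1, pr2⟩⟩)).
Proof.
rewrite /integral app_lam appmS weakenE; congr appm.
apply: expo_ext => H' s' a; rewrite compA app_lam appmS !compE app_curry.
rewrite appmS !compE; congr appm.
apply: expo_ext => H'' s'' b; rewrite !compA app_lam appmS !compE.
by rewrite !app_curry !compE.
Qed.

Lemma integral_convt G A B (f : mor G (dist M A)) (g : mor G (dist M B))
    H (s : mor H G) k :
  integral (convt f g ∘ s) k =
  integral (g ∘ s)
    (integral (f ∘ (s ∘ pr1)) (k ∘ ⟨pr1 ∘ pr1, ⟨pr2, pr2 ∘ pr1⟩⟩)).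
Proof.
rewrite /integral app_lam appmS weakenE; congr appm.
apply: expo_ext => H' s' a; rewrite compA app_lam appmS !compE app_curry.
rewrite appmS !compE; congr appm.
apply: expo_ext => H'' s'' b; rewrite !compA app_lam appmS !compE.
by rewrite !app_curry !compE.
Qed.

Lemma convS G A B (f : mor G (dist M A)) (g : mor G (dist M B)) H (s : mor H G) :
  conv f g ∘ s = conv (f ∘ s) (g ∘ s).
Proof. by apply: dist_ext => H' t k; rewrite compA !integral_conv !compA. Qed.

Lemma convtS G A B (f : mor G (dist M A)) (g : mor G (dist M B)) H (s : mor H G) :
  convt f g ∘ s = convt (f ∘ s) (g ∘ s).
Proof. by apply: dist_ext => H' t k; rewrite compA !integral_convt !compA. Qed.

Lemma pushS G A B (u : mor A B) (f : mor G (dist M A)) H (s : mor H G) :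
  push u f ∘ s = push u (f ∘ s).
Proof. by apply: dist_ext => H' t k; rewrite compA !integral_push !compA. Qed.

Lemma diracS G A (a : mor G A) H (s : mor H G) : dirac M a ∘ s = dirac M (a ∘ s).
Proof. by apply: dist_ext => H' t k; rewrite compA !integral_dirac !compA. Qed.

Lemma push_push G A B C (u : mor A B) (v : mor B C) (f : mor G (dist M A)) :
  push v (push u f) = push (v ∘ u) f.
Proof. by apply: dist_ext => H s k; rewrite !integral_push !compE. Qed.

Lemma push_id G A (f : mor G (dist M A)) : push (idm A) f = f.
Proof. by apply: dist_ext => H s k; rewrite integral_push mcomp1m pair_pr mcompm1. Qed.

(** Integration against a Dirac distribution is a substitution, and substitutions commute with every
    integral. *)
Lemma conv_dirac_l G A B (a : mor G A) (g : mor G (dist M B)) :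
  conv (dirac M a) g = convt (dirac M a) g.
Proof.
apply: dist_ext => H s k; rewrite integral_conv integral_convt !integral_dirac.
by rewrite integralS !compE.
Qed.

Lemma conv_dirac_r G A B (f : mor G (dist M A)) (b : mor G B) :
  conv f (dirac M b) = convt f (dirac M b).
Proof.
apply: dist_ext => H s k; rewrite integral_conv integral_convt !integral_dirac.
by rewrite integralS !compE.
Qed.

Lemma conv_dirac G A B (a : mor G A) (b : mor G B) :
  conv (dirac M a) (dirac M b) = dirac M ⟨a, b⟩.
Proof.
by apply: dist_ext => H s k; rewrite integral_conv !integral_dirac !compE.
Qed.

(** Forgetting a Dirac factor loses nothing; this lets [inner] recover distributions on [B × C] from
    distributions on [A × (B × C)]. *)
Lemma push_conv_dirac G A B (a : mor G A) (g : mor G (dist M B)) :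
  push pr2 (conv (dirac M a) g) = g.
Proof.
apply: dist_ext => H s k; rewrite integral_push integral_conv integral_dirac.
by rewrite integralS !compE pair_pr mcompm1.
Qed.

Section Orders.
Context {G A B C : E}.
Variables (f1 : mor G (dist M A)) (f2 : mor G (dist M B)) (f3 : mor G (dist M C)).

(** The indices list the distributions from the outermost integration to the innermost. In 213 and
    312 the first one stands in the middle, so the product is formed on [B × (C × A)] and then
    rotated. *)
Definition order_123 := conv f1 (conv f2 f3).
Definition order_132 := conv f1 (convt f2 f3).
Definition order_231 := convt f1 (conv f2 f3).
Definition order_321 := convt f1 (convt f2 f3).
Definition order_213 := push (rotate_bca A B C) (conv f2 (convt f3 f1)).
Definition order_312 := push (rotate_bca A B C) (convt f2 (conv f3 f1)).

Ltac integral_calc := apply: dist_ext => H s k; rewrite /rotate_bca /rotate_cab;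
  rewrite ?(integral_push, integral_conv, integral_convt) /integral /appm;
  by rewrite !(curryS, compE).

(** Different bracketings of cyclically permuted factors give the same order of integration. These
    equalities express the six products in the form in which the second and third brackets produce
    them. *)
Lemma order_132_bca : order_132 = push (rotate_bca A B C) (convt f2 (convt f3 f1)).
Proof. integral_calc. Qed.

Lemma order_231_bca : order_231 = push (rotate_bca A B C) (conv f2 (conv f3 f1)).
Proof. integral_calc. Qed.

Lemma order_123_cab : order_123 = push (rotate_cab A B C) (convt f3 (conv f1 f2)).
Proof. integral_calc. Qed.

Lemma order_213_cab : order_213 = push (rotate_cab A B C) (convt f3 (convt f1 f2)).
Proof. integral_calc. Qed.

Lemma order_312_cab : order_312 = push (rotate_cab A B C) (conv f3 (conv f1 f2)).
Proof. integral_calc. Qed.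

Lemma order_321_cab : order_321 = push (rotate_cab A B C) (conv f3 (convt f1 f2)).
Proof. integral_calc. Qed.

End Orders.

Section DiracOrders.
Context {G A B C : E}.
Implicit Types (f : mor G (dist M A)) (g : mor G (dist M B)) (h : mor G (dist M C)).
Implicit Types (a : mor G A) (b : mor G B) (c : mor G C).

(** A Dirac factor may stand anywhere, so only the relative order of the other two distributions
    matters. *)
Lemma order_dirac1 a g h : let f := dirac M a in
  [/\ order_123 f g h = order_213 f g h,
      order_213 f g h = order_231 f g h,
      order_132 f g h = order_312 f g h &
      order_312 f g h = order_321 f g h].
Proof.
split; rewrite ?order_213_cab ?order_312_cab ?order_123_cab ?order_321_cab ?conv_dirac_l //.
- by rewrite -order_213_cab /order_213 order_231_bca conv_dirac_r.
- by rewrite -order_321_cab /order_132 /order_321 conv_dirac_l.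
Qed.

Lemma order_dirac2 f b h : let g := dirac M b in
  [/\ order_213 f g h = order_123 f g h,
      order_123 f g h = order_132 f g h,
      order_231 f g h = order_321 f g h &
      order_321 f g h = order_312 f g h].
Proof.
split; rewrite ?order_213_cab ?order_312_cab ?order_123_cab ?order_321_cab ?conv_dirac_r //.
- by rewrite -conv_dirac_r -order_123_cab /order_123 /order_132 conv_dirac_l.
- by rewrite -order_321_cab /order_231 /order_321 conv_dirac_l.
Qed.

Lemma order_dirac3 f g c : let h := dirac M c in
  [/\ order_123 f g h = order_132 f g h,
      order_132 f g h = order_312 f g h,
      order_213 f g h = order_231 f g h &
      order_231 f g h = order_321 f g h].
Proof.
split; rewrite ?/order_123 ?/order_132 ?/order_231 ?/order_321 ?conv_dirac_r //.
- by rewrite -/(order_132 _ _ _) order_132_bca /order_312 conv_dirac_l.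
- by rewrite -conv_dirac_r -/(order_231 _ _ _) order_231_bca /order_213 conv_dirac_l.
Qed.

End DiracOrders.
End Distributions.

(** * The iterated bracket *)

Section Bracket.
Context {E : universe} {R : ring_object E} {M : E}.
Hypotheses (KL : kock_lawvere R) (mM : microlinear R M).
Implicit Types G H A B C X : E.

Lemma app_icon_conv G A B (xi1 : mor G (D R ⇒ dist M A)) (xi2 : mor G (D R ⇒ dist M B))
    H (s : mor H G) d1 d2 :
  appm (icon_conv xi1 xi2 ∘ s) ⟨d1, d2⟩ =
  conv (appm (xi1 ∘ s) d1) (appm (xi2 ∘ s) d2).
Proof. by rewrite app_lam convS !appmS !weakenE !compE. Qed.

Lemma app_icon_convt G A B (xi1 : mor G (D R ⇒ dist M A)) (xi2 : mor G (D R ⇒ dist M B))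
    H (s : mor H G) d1 d2 :
  appm (icon_convt xi1 xi2 ∘ s) ⟨d1, d2⟩ =
  convt (appm (xi1 ∘ s) d1) (appm (xi2 ∘ s) d2).
Proof. by rewrite app_lam convtS !appmS !weakenE !compE. Qed.

Lemma app_icon_push G A B (u : mor A B) (xi : mor G (D R ⇒ dist M A))
    H (s : mor H G) d :
  appm (icon_push u xi ∘ s) d = push u (appm (xi ∘ s) d).
Proof. by rewrite app_lam pushS !appmS !weakenE !compE. Qed.

Lemma app_icon0 G A (a : mor G A) (xi : mor G (D R ⇒ dist M A)) H (s : mor H G) :
  is_icon1 a xi -> appm (xi ∘ s) (zeroD R H) = dirac M (a ∘ s).
Proof. by move=> xi0; rewrite -(zeroDS R s) -appmS xi0 diracS. Qed.

Lemma D3e_relations (K : comPzRingType) (y : seq nat -> K) : is_pt cD3e y ->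
  let a := y [:: 0%N] in let b := y [:: 1%N] in let c := y [:: 1; 0]%N in
  [/\ a * a = 0, b * b = 0, c * c = 0, a * c = 0 & b * c = 0].
Proof. by move=> py; split; rewrite (pt_mul py (L := [::])). Qed.

Definition left_vals (K : comPzRingType) (d : K) (y : seq nat -> K) : seq K :=
  let a := y [:: 0%N] in let b := y [:: 1%N] in let c := y [:: 1; 0]%N in
  [:: d; a; b; d * a; 0; d * b; 0; a * b - c; c; d * (a * b - c); d * c; 0; 0; 0; 0].

Definition right_vals (K : comPzRingType) (d : K) (y : seq nat -> K) : seq K :=
  let a := y [:: 0%N] in let b := y [:: 1%N] in let c := y [:: 1; 0]%N in
  [:: d; a; b; 0; d * a; 0; d * b; a * b - c; c; 0; 0; 0; d * (a * b - c); 0; d * c].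

Definition bracket_vals (K : comPzRingType) (y : seq nat -> K) : seq K :=
  let a := y [:: 0%N] in let b := y [:: 1%N] in let c := y [:: 1; 0]%N in
  [:: a; 0; 0; 0; 0; 0; 0; - b; b; - (a * b - c); a * b - c; 0; - c; 0; c].

Lemma is_pt_below3 (K : comPzRingType) (v : seq nat) (x : seq K) :
  is_pt c3 (lookup c3 x) ->
  foldr (fun w P => lookup c3 x w = 0 /\ P) True [seq w <- words3 | ~~ subseq w v] ->
  is_pt (below c3 v) (lookup c3 x).
Proof.
move=> px zx; apply: (is_pt_sub _ px) => [|w wv]; first exact: below_le.
have [wO|/px.1 //] := boolP (w \in words c3).
have : w \in [seq w <- words3 | ~~ subseq w v].
  by rewrite mem_filter; move: wv; rewrite mem_below wO andbT => ->.
by elim: [seq _ <- _ | _] zx => //= u t IH [x0 /IH tx]; rewrite inE => /predU1P[->|].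
Qed.

Section OnePoint.
Context {K : comPzRingType} {y : seq nat -> K} {d : K}.
Hypothesis dd : d * d = 0.

Lemma left_vals_pt : is_pt cD3e y -> is_pt c3 (lookup c3 (left_vals d y)).
Proof. by case/D3e_relations => *; apply: left_pt. Qed.

Lemma right_vals_pt : is_pt cD3e y -> is_pt c3 (lookup c3 (right_vals d y)).
Proof. by case/D3e_relations => *; apply: right_pt. Qed.

Lemma bracket_vals_pt : is_pt cD3e y -> is_pt c3 (lookup c3 (bracket_vals y)).
Proof. by case/D3e_relations => *; apply: bracket_pt. Qed.

Lemma word01_val : is_pt (below cD3e word01) y -> y [:: 1; 0]%N = 0.
Proof. by case=> ->. Qed.

Lemma word10_val : is_pt (below cD3e word10) y ->
  y [:: 1; 0]%N = y [:: 0%N] * y [:: 1%N].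
Proof. by move=> py; rewrite (pt_mul (L := [:: word10]) py) //= addr0. Qed.

(** For [c = 0] or [c = a b], the polynomials of [left_pt] and [right_pt] factor into [1 + d X],
    [1 + a Y] and [1 + b Z]. The order of the factors names the cube, here and in the next three
    lemmas. *)
Lemma left_vals01 : is_pt (below cD3e word01) y ->
  is_pt (below c3 [:: 0; 1; 2]%N) (lookup c3 (left_vals d y)).
Proof.
move=> py; apply: is_pt_below3; first exact/left_vals_pt/(is_pt_mono (@below_le _ _ _))/py.
by rewrite /left_vals (word01_val py) /lookup /= mulr0; do ?split.
Qed.

Lemma left_vals10 : is_pt (below cD3e word10) y ->
  is_pt (below c3 [:: 0; 2; 1]%N) (lookup c3 (left_vals d y)).
Proof.
move=> py; apply: is_pt_below3; first exact/left_vals_pt/(is_pt_mono (@below_le _ _ _))/py.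
by rewrite /left_vals (word10_val py) /lookup /= subrr mulr0; do ?split.
Qed.

Lemma right_vals01 : is_pt (below cD3e word01) y ->
  is_pt (below c3 [:: 1; 2; 0]%N) (lookup c3 (right_vals d y)).
Proof.
move=> py; apply: is_pt_below3; first exact/right_vals_pt/(is_pt_mono (@below_le _ _ _))/py.
by rewrite /right_vals (word01_val py) /lookup /= mulr0; do ?split.
Qed.

Lemma right_vals10 : is_pt (below cD3e word10) y ->
  is_pt (below c3 [:: 2; 1; 0]%N) (lookup c3 (right_vals d y)).
Proof.
move=> py; apply: is_pt_below3; first exact/right_vals_pt/(is_pt_mono (@below_le _ _ _))/py.
by rewrite /right_vals (word10_val py) /lookup /= subrr mulr0; do ?split.
Qed.

End OnePoint.

Definition icon_at G A (xi : mor G (D R ⇒ dist M A)) (i : nat) H (s : mor H G)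
    (x : seq nat -> mor H R) : mor H (dist M A) := appm (xi ∘ s) (to_D (x [:: i])).

Lemma icon_atS G A (xi : mor G (D R ⇒ dist M A)) i O H (s : mor H G) x H' (t : mor H' H) :
  is_pt O x -> icon_at xi i s x ∘ t = icon_at xi i (s ∘ t) (fun w => x w ∘ t).
Proof. by move=> px; rewrite /icon_at appmS compA to_DS // (is_pt_sq _ px). Qed.

Context {G A B C : E}.
Variables (a0 : mor G A) (xi1 : mor G (D R ⇒ dist M A)).
Variables (xi2 : mor G (D R ⇒ dist M B)) (xi3 : mor G (D R ⇒ dist M C)).
Hypothesis icon1 : is_icon1 a0 xi1.
Variable K : family (T := nat) R (dist M (A × (B × C))) G.
Hypothesis natK : natural c3 K.

(** These four orders have the first icon outermost or innermost, as in the two products of [xi1]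
    with a bracket of [xi2] and [xi3]. *)
Hypothesis K012 : forall H (s : mor H G) x, is_pt (below c3 [:: 0; 1; 2]%N) x ->
  K s x = conv (icon_at xi1 0 s x) (conv (icon_at xi2 1 s x) (icon_at xi3 2 s x)).
Hypothesis K021 : forall H (s : mor H G) x, is_pt (below c3 [:: 0; 2; 1]%N) x ->
  K s x = conv (icon_at xi1 0 s x) (convt (icon_at xi2 1 s x) (icon_at xi3 2 s x)).
Hypothesis K120 : forall H (s : mor H G) x, is_pt (below c3 [:: 1; 2; 0]%N) x ->
  K s x = convt (icon_at xi1 0 s x) (conv (icon_at xi2 1 s x) (icon_at xi3 2 s x)).
Hypothesis K210 : forall H (s : mor H G) x, is_pt (below c3 [:: 2; 1; 0]%N) x ->
  K s x = convt (icon_at xi1 0 s x) (convt (icon_at xi2 1 s x) (icon_at xi3 2 s x)).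

(** With coefficient 0 at the letter X the first icon is a Dirac distribution, which [pr2] forgets.
    What remains glues the two products of [xi2] and [xi3]. *)
Definition inner : family (T := nat) R (dist M (B × C)) G :=
  fun H s y => push pr2 (K s (lookup c3 (left_vals 0 y))).

Lemma left_valsS H (d : mor H R) (y : seq nat -> mor H R) H' (t : mor H' H) :
  (fun w => lookup c3 (left_vals d y) w ∘ t) =
  lookup c3 (left_vals (d ∘ t) (fun w => y w ∘ t)).
Proof.
apply: funext => w; rewrite lookupS /left_vals /=.
by rewrite !(mcomp_mulr, mcomp_subr, mcomp_0r).
Qed.

Lemma right_valsS H (d : mor H R) (y : seq nat -> mor H R) H' (t : mor H' H) :
  (fun w => lookup c3 (right_vals d y) w ∘ t) =
  lookup c3 (right_vals (d ∘ t) (fun w => y w ∘ t)).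
Proof.
apply: funext => w; rewrite lookupS /right_vals /=.
by rewrite !(mcomp_mulr, mcomp_subr, mcomp_0r).
Qed.

Lemma bracket_valsS H (y : seq nat -> mor H R) H' (t : mor H' H) :
  (fun w => lookup c3 (bracket_vals y) w ∘ t) =
  lookup c3 (bracket_vals (fun w => y w ∘ t)).
Proof.
apply: funext => w; rewrite lookupS /bracket_vals /=.
by rewrite !(mcomp_mulr, mcomp_subr, mcomp_0r, mcomp_oppr).
Qed.

Lemma inner_natural : natural cD3e inner.
Proof.
move=> H s y H' t py; rewrite /inner pushS natK; last exact: left_vals_pt (mulr0 0) py.
by rewrite left_valsS mcomp_0r.
Qed.

Lemma inner01 H (s : mor H G) y : is_pt (below cD3e word01) y ->
  inner s y = conv (icon_at xi2 0 s y) (icon_at xi3 1 s y).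
Proof.
move=> py; rewrite /inner K012; last exact: left_vals01 (mulr0 0) py.
by rewrite /icon_at /lookup /= to_D0 (app_icon0 _ icon1) push_conv_dirac.
Qed.

Lemma inner10 H (s : mor H G) y : is_pt (below cD3e word10) y ->
  inner s y = convt (icon_at xi2 0 s y) (icon_at xi3 1 s y).
Proof.
move=> py; rewrite /inner K021; last exact: left_vals10 (mulr0 0) py.
by rewrite /icon_at /lookup /= to_D0 (app_icon0 _ icon1) push_conv_dirac.
Qed.

Lemma inner_bracket H (s : mor H G) e :
  appm (icon_bracket xi2 xi3 ∘ s) e = inner s (lookup cD3e [:: 0; 0; - valD e; valD e]).
Proof.
rewrite /icon_bracket (strong_diff_eval KL (@microlinear_dist _ _ _ _ mM) inner_natural) //.
  by move=> H' t y py; rewrite app_icon_conv inner01.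
by move=> H' t y py; rewrite app_icon_convt inner10.
Qed.

(** For fixed [d] both sides are natural families in [y], and on the two squares of [cD3e] they
    agree by [K012] and [K021]. *)
Lemma conv_inner H (s : mor H G) (d : mor H R) y : d * d = 0 -> is_pt cD3e y ->
  conv (appm (xi1 ∘ s) (to_D d)) (inner s y) = K s (lookup c3 (left_vals d y)).
Proof.
move=> dd py.
have ddS H' (t : mor H' H) : (d ∘ t) * (d ∘ t) = 0 by rewrite -mcomp_mulr dd mcomp_0r.
pose L H' (t : mor H' H) y :=
  conv (appm (xi1 ∘ (s ∘ t)) (to_D (d ∘ t))) (inner (s ∘ t) y).
pose L' H' (t : mor H' H) y := K (s ∘ t) (lookup c3 (left_vals (d ∘ t) y)).
suff : L H (idm H) y = L' H (idm H) y by rewrite /L /L' !mcompm1.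
apply: (D3e_family_eq KL (@microlinear_dist _ _ _ _ mM) (L := L) (L' := L')) py =>
  [H' t z H'' t' pz|H' t z H'' t' pz|H' t z pz|H' t z pz].
- by rewrite /L convS appmS to_DS // inner_natural // !compA.
- by rewrite /L' natK; [rewrite left_valsS !compA|exact: left_vals_pt (ddS _ t) pz].
- rewrite /L /L' inner01 // K012; last exact: left_vals01 (ddS _ t) pz.
  by rewrite /icon_at.
rewrite /L /L' inner10 // K021; last exact: left_vals10 (ddS _ t) pz.
by rewrite /icon_at.
Qed.

Lemma convt_inner H (s : mor H G) (d : mor H R) y : d * d = 0 -> is_pt cD3e y ->
  convt (appm (xi1 ∘ s) (to_D d)) (inner s y) = K s (lookup c3 (right_vals d y)).
Proof.
move=> dd py.
have ddS H' (t : mor H' H) : (d ∘ t) * (d ∘ t) = 0 by rewrite -mcomp_mulr dd mcomp_0r.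
pose L H' (t : mor H' H) y :=
  convt (appm (xi1 ∘ (s ∘ t)) (to_D (d ∘ t))) (inner (s ∘ t) y).
pose L' H' (t : mor H' H) y := K (s ∘ t) (lookup c3 (right_vals (d ∘ t) y)).
suff : L H (idm H) y = L' H (idm H) y by rewrite /L /L' !mcompm1.
apply: (D3e_family_eq KL (@microlinear_dist _ _ _ _ mM) (L := L) (L' := L')) py =>
  [H' t z H'' t' pz|H' t z H'' t' pz|H' t z pz|H' t z pz].
- by rewrite /L convtS appmS to_DS // inner_natural // !compA.
- by rewrite /L' natK; [rewrite right_valsS !compA|exact: right_vals_pt (ddS _ t) pz].
- rewrite /L /L' inner01 // K120; last exact: right_vals01 (ddS _ t) pz.
  by rewrite /icon_at.
rewrite /L /L' inner10 // K210; last exact: right_vals10 (ddS _ t) pz.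
by rewrite /icon_at.
Qed.

Lemma axis_pt H (c : mor H R) : c * c = 0 ->
  is_pt cD3e (lookup cD3e [:: 0; 0; - c; c]).
Proof.
move=> cc; have := @D3e_pt _ 0 0 c; rewrite mulr0 sub0r mul0r.
by apply.
Qed.

(** The polynomial of [bracket_vals] is [(1 + a X) (1 + b (ZY - YZ))] for [c = 0] and has the
    factors in the other order for [c = a b]. So it carries the outer strong difference, and
    [a = b = 0], [c = e] gives [1 + e [X, [Y, Z]]]; the sign of the inner bracket cancels that of
    the outer one. *)
Lemma bracket_eval H (s : mor H G) e :
  appm (icon_bracket xi1 (icon_bracket xi2 xi3) ∘ s) e =
  K s (lookup c3 [:: 0; 0; 0; 0; 0; 0; 0; 0; 0;
                     valD e; - valD e; 0; - valD e; 0; valD e]).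
Proof.
pose L H (s : mor H G) (y : seq nat -> mor H R) := K s (lookup c3 (bracket_vals y)).
have natL : natural cD3e L.
  by move=> H' t y H'' t' py; rewrite /L natK ?bracket_valsS //; apply: bracket_vals_pt.
rewrite {1}/icon_bracket (strong_diff_eval KL (@microlinear_dist _ _ _ _ mM) natL) =>
  [|H' t y py|H' t y py].
- by rewrite /L /bracket_vals /lookup /= mulr0 sub0r opprK oppr0.
(* The square [c = 0]: the first icon is taken at [a] and the inner bracket at [b]. *)
- have bb : y [:: 1%N] * y [:: 1%N] = 0 by apply: is_pt_sq py.
  rewrite app_icon_conv inner_bracket conv_inner ?(is_pt_sq _ py) //; last first.
    by rewrite valD_to_D //; apply: axis_pt.
  rewrite valD_to_D // /L /bracket_vals /left_vals /lookup /= (word01_val py).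
  by rewrite !mulr0 !subr0 !sub0r oppr0 mulrN.
(* The square [c = a b], with the factors in the other order. *)
have bb : y [:: 1%N] * y [:: 1%N] = 0 by apply: is_pt_sq py.
rewrite app_icon_convt inner_bracket convt_inner ?(is_pt_sq _ py) //; last first.
  by rewrite valD_to_D //; apply: axis_pt.
rewrite valD_to_D // /L /bracket_vals /right_vals /lookup /= (word10_val py).
by rewrite !mulr0 !sub0r subrr oppr0 mulrN.
Qed.

End Bracket.

(** * The Jacobi identity *)

Section Relabel.
Context {T : eqType} (rho : T -> T).
Hypothesis rho_inj : injective rho.

Lemma shuf_map (u v w : seq T) :
  shuf (map rho u) (map rho v) (map rho w) = shuf u v w.
Proof.
have filterE z : filter (mem (map rho z)) (map rho w) = map rho (filter (mem z) w).
  by rewrite filter_map; congr map; apply: eq_filter => a /=; rewrite mem_map.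
rewrite /shuf !filterE !(inj_eq (inj_map rho_inj)) all_map; congr [&& _, _ & _].
by apply: eq_all => a /=; rewrite !mem_map.
Qed.

Lemma is_pt_relabel (K : comPzRingType) (O O' : complex T) (x : seq T -> K) :
  perm_eq [seq map rho w | w <- words O'] (words O) ->
  is_pt O x -> is_pt O' (fun w => x (map rho w)).
Proof.
move=> permO [x0 xM].
have memO w : (map rho w \in words O) = (w \in words O').
  by rewrite -(perm_mem permO) (mem_map (inj_map rho_inj)).
split=> [w wO|u v uO vO]; first by rewrite x0 // memO.
rewrite xM ?memO // -(perm_big _ permO) big_map.
by apply: eq_bigl => w; rewrite shuf_map.
Qed.

End Relabel.

(** [rot1] sends the letter of an icon to its position in the arrangement [xi2], [xi3], [xi1];
    [rot2] does so for [xi3], [xi1], [xi2]. *)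
Definition rot1 (a : nat) : nat :=
  match a with 0 => 2 | 1 => 0 | 2 => 1 | _ => a end%N.
Definition rot2 (a : nat) : nat :=
  match a with 0 => 1 | 1 => 2 | 2 => 0 | _ => a end%N.

Lemma rot1_inj : injective rot1.
Proof. by move=> [|[|[|a]]] [|[|[|b]]]. Qed.

Lemma rot2_inj : injective rot2.
Proof. by move=> [|[|[|a]]] [|[|[|b]]]. Qed.

Lemma rotate_bcaK (E : universe) (A B C : E) :
  rotate_cab B C A ∘ rotate_bca A B C = idm _ /\
  rotate_bca A B C ∘ rotate_cab B C A = idm _.
Proof. by rewrite /rotate_bca /rotate_cab !compE !pair_eta !pair_pr. Qed.

(** A short word is a subword of several orders, and the first match is taken; [pick_order_compat]
    makes the choice harmless. *)
Definition pick_order (w : seq nat) (X : Type) (o123 o132 o213 o231 o312 o321 : X) : X :=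
  if subseq w [:: 0; 1; 2]%N then o123
  else if subseq w [:: 0; 2; 1]%N then o132
  else if subseq w [:: 1; 0; 2]%N then o213
  else if subseq w [:: 1; 2; 0]%N then o231
  else if subseq w [:: 2; 0; 1]%N then o312
  else o321.

(** The hypotheses let a letter missing from [u] move freely. Two orders containing [u] then differ
    only by such moves, which is checked for every pair of words. *)
Lemma pick_order_compat X (o123 o132 o213 o231 o312 o321 : X) u w :
  (0%N \notin u -> [/\ o123 = o213, o213 = o231, o132 = o312 & o312 = o321]) ->
  (1%N \notin u -> [/\ o213 = o123, o123 = o132, o231 = o321 & o321 = o312]) ->
  (2%N \notin u -> [/\ o123 = o132, o132 = o312, o213 = o231 & o231 = o321]) ->
  u \in [::] :: words3 -> w \in [::] :: words3 -> subseq u w ->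
  pick_order w o123 o132 o213 o231 o312 o321 =
  pick_order u o123 o132 o213 o231 o312 o321.
Proof.
move=> h1 h2 h3 uO wO uw; have {uw}wO : w \in [seq w <- [::] :: words3 | subseq u w].
  by rewrite mem_filter uw.
rewrite !inE in uO; repeat (case/orP: uO => [/eqP uE|uO]); last move/eqP: uO => uE;
  rewrite {}uE /= !inE in h1 h2 h3 wO *;
  try (case: (h1 isT) => ? ? ? ?); try (case: (h2 isT) => ? ? ? ?);
  try (case: (h3 isT) => ? ? ? ?); clear h1 h2 h3;
  repeat (case/orP: wO => [/eqP ->|wO]); try move/eqP: wO => ->;
  rewrite /pick_order /=; congruence.
Qed.

Section Jacobi.
Context {E : universe} {R : ring_object E} {M : E}.
Hypotheses (KL : kock_lawvere R) (mM : microlinear R M).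
Context {G A B C : E}.
Variables (a0 : mor G A) (b0 : mor G B) (c0 : mor G C).
Variables (xi1 : mor G (D R ⇒ dist M A)) (xi2 : mor G (D R ⇒ dist M B)).
Variable xi3 : mor G (D R ⇒ dist M C).
Hypotheses (icon1 : is_icon1 a0 xi1) (icon2 : is_icon1 b0 xi2) (icon3 : is_icon1 c0 xi3).

Definition cube (w : seq nat) : family (T := nat) R (dist M (A × (B × C))) G :=
  fun H s x =>
    let f1 := icon_at xi1 0 s x in let f2 := icon_at xi2 1 s x in
    let f3 := icon_at xi3 2 s x in
    pick_order w (order_123 f1 f2 f3) (order_132 f1 f2 f3) (order_213 f1 f2 f3)
      (order_231 f1 f2 f3) (order_312 f1 f2 f3) (order_321 f1 f2 f3).

Lemma cube_natural (w : seq nat) : natural (below c3 w) (cube w).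
Proof.
move=> H s x H' t px; rewrite /cube /pick_order.
do !case: ifP => _; rewrite /order_123 /order_132 /order_213 /order_231 /order_312
  /order_321; by rewrite !(pushS, convS, convtS) !(icon_atS _ _ _ _ px).
Qed.

(** On the cube of [u] the coordinate of a missing letter is 0, where the icon of that letter is a
    Dirac distribution. *)
Lemma cube_compat : {in [::] :: words3 &, forall u w, subseq u w ->
  forall H (s : mor H G) x, is_pt (below c3 u) x -> cube w s x = cube u s x}.
Proof.
move=> u w uO wO uw H s x px; rewrite /cube.
have [f1E f2E f3E] : [/\ 0%N \notin u -> icon_at xi1 0 s x = dirac M (a0 ∘ s),
    1%N \notin u -> icon_at xi2 1 s x = dirac M (b0 ∘ s) &
    2%N \notin u -> icon_at xi3 2 s x = dirac M (c0 ∘ s)].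
  have x0 i : i \notin u -> x [:: i] = 0.
    by move=> iu; rewrite px.1 // mem_below sub1seq (negPf iu).
  split=> /x0 xi0; rewrite /icon_at xi0 to_D0.
  - exact: app_icon0 icon1.
  - exact: app_icon0 icon2.
  exact: app_icon0 icon3.
move: (icon_at xi1 0 s x) (icon_at xi2 1 s x) (icon_at xi3 2 s x) f1E f2E f3E.
move=> f1 f2 f3 f1E f2E f3E.
by apply: pick_order_compat => // [/f1E ->|/f2E ->|/f3E ->];
  [apply: order_dirac1|apply: order_dirac2|apply: order_dirac3].
Qed.

End Jacobi.

Lemma lookup_eq (T : eqType) (K : comPzRingType) (O : complex T) (s : seq K)
    (x : seq T -> K) :
  size s = size (words O) -> (forall w, w \notin words O -> x w = 0) ->
  [seq x w | w <- words O] = s -> x = lookup O s.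
Proof.
move=> szs x0 xs; apply: funext => w; rewrite /lookup.
have [wO|wO] := boolP (w \in words O).
  by rewrite -xs (nth_map [::]) ?index_mem // nth_index.
by rewrite x0 // nth_default // szs memNindex.
Qed.

Section JacobiSum.
Context {E : universe} {R : ring_object E} {M : E}.
Hypotheses (KL : kock_lawvere R) (mM : microlinear R M).
Context {G A B C : E}.
Variables (a0 : mor G A) (b0 : mor G B) (c0 : mor G C).
Variables (xi1 : mor G (D R ⇒ dist M A)) (xi2 : mor G (D R ⇒ dist M B)).
Variable xi3 : mor G (D R ⇒ dist M C).
Hypotheses (icon1 : is_icon1 a0 xi1) (icon2 : is_icon1 b0 xi2) (icon3 : is_icon1 c0 xi3).

Variable K : mor G (shuf_spec R c3 ⇒ dist M (A × (B × C))).
Hypothesis K_cube : {in [::] :: words3, forall w H (s : mor H G) x,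
  is_pt (below c3 w) x -> val_at K s x = cube xi1 xi2 xi3 w s x}.

Definition top_pt (F : comPzRingType) (a b c d e f : F) : seq nat -> F :=
  lookup c3 [:: 0; 0; 0; 0; 0; 0; 0; 0; 0; a; b; c; d; e; f].

Lemma bracket1_eval H (s : mor H G) e :
  appm (icon_bracket xi1 (icon_bracket xi2 xi3) ∘ s) e =
  val_at K s (top_pt (valD e) (- valD e) 0 (- valD e) 0 (valD e)).
Proof.
apply: (bracket_eval KL mM icon1 (val_at_natural K)) => H' t x px;
  exact: (K_cube _ _ px).
Qed.

Lemma top_pt_bracket (F : comPzRingType) (e : F) : e * e = 0 ->
  is_pt c3 (top_pt e (- e) 0 (- e) 0 e).
Proof.
move=> ee; have := @bracket_sum_pt _ e 0 ee (mulr0 _) (mulr0 _).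
by rewrite sub0r oppr0.
Qed.

(** The values are those of [1 + e [Y, [Z, X]]]. They come from [bracket_eval] for [xi2], [xi3],
    [xi1], applied to [K] with its letters renamed and its distributions rotated. *)
Lemma bracket2_eval H (s : mor H G) e :
  appm (icon_push (rotate_bca A B C) (icon_bracket xi2 (icon_bracket xi3 xi1)) ∘ s) e =
  val_at K s (top_pt 0 (valD e) (- valD e) (valD e) (- valD e) 0).
Proof.
pose K' H (s : mor H G) (x : seq nat -> mor H R) :=
  push (rotate_cab B C A) (val_at K s (fun w => x (map rot1 w))).
have invl : rotate_cab B C A ∘ rotate_bca A B C = idm _ by case: (rotate_bcaK A B C).
have invr : rotate_bca A B C ∘ rotate_cab B C A = idm _ by case: (rotate_bcaK A B C).
have natK' : natural c3 K'.
  move=> H' t x H'' t' px; rewrite /K' pushS (val_at_natural K) //.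
  exact: (is_pt_relabel rot1_inj _ px).
(* The cube of [v] for [K] becomes the cube of the renamed word for [K'], once its product is
   written with the rotated factors. *)
have K'E v H' (t : mor H' G) x f : v \in [::] :: words3 ->
    perm_eq [seq map rot1 w | w <- words (below c3 v)] (words (below c3 (map rot1 v))) ->
    is_pt (below c3 (map rot1 v)) x ->
    cube xi1 xi2 xi3 v t (fun w => x (map rot1 w)) = push (rotate_bca A B C) f ->
    K' H' t x = f.
  move=> v3 vv px fE; rewrite /K' (K_cube v3 _ (is_pt_relabel rot1_inj vv px)) fE.
  by rewrite push_push invl push_id.
rewrite app_icon_push (bracket_eval KL mM icon2 natK').
- rewrite /K' push_push invr push_id; congr val_at; apply: lookup_eq => // w.
  exact: (is_pt_relabel (O := c3) rot1_inj _ (top_pt_bracket (valD_sqr e))).1.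
- by move=> H' t x px; apply: (K'E [:: 1; 2; 0]%N) => //; apply: order_231_bca.
- by move=> H' t x px; apply: (K'E [:: 1; 0; 2]%N).
- by move=> H' t x px; apply: (K'E [:: 2; 0; 1]%N).
by move=> H' t x px; apply: (K'E [:: 0; 2; 1]%N) => //; apply: order_132_bca.
Qed.

(** The same transport for the arrangement [xi3], [xi1], [xi2] gives the values of [1 + e [Z,
    [X, Y]]]. *)
Lemma bracket3_eval H (s : mor H G) e :
  appm (icon_push (rotate_cab A B C) (icon_bracket xi3 (icon_bracket xi1 xi2)) ∘ s) e =
  val_at K s (top_pt (- valD e) 0 (valD e) 0 (valD e) (- valD e)).
Proof.
pose K' H (s : mor H G) (x : seq nat -> mor H R) :=
  push (rotate_bca C A B) (val_at K s (fun w => x (map rot2 w))).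
have invl : rotate_bca C A B ∘ rotate_cab A B C = idm _ by case: (rotate_bcaK C A B).
have invr : rotate_cab A B C ∘ rotate_bca C A B = idm _ by case: (rotate_bcaK C A B).
have natK' : natural c3 K'.
  move=> H' t x H'' t' px; rewrite /K' pushS (val_at_natural K) //.
  exact: (is_pt_relabel rot2_inj _ px).
have K'E v H' (t : mor H' G) x f : v \in [::] :: words3 ->
    perm_eq [seq map rot2 w | w <- words (below c3 v)] (words (below c3 (map rot2 v))) ->
    is_pt (below c3 (map rot2 v)) x ->
    cube xi1 xi2 xi3 v t (fun w => x (map rot2 w)) = push (rotate_cab A B C) f ->
    K' H' t x = f.
  move=> v3 vv px fE; rewrite /K' (K_cube v3 _ (is_pt_relabel rot2_inj vv px)) fE.
  by rewrite push_push invl push_id.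
rewrite app_icon_push (bracket_eval KL mM icon3 natK').
- rewrite /K' push_push invr push_id; congr val_at; apply: lookup_eq => // w.
  exact: (is_pt_relabel (O := c3) rot2_inj _ (top_pt_bracket (valD_sqr e))).1.
- by move=> H' t x px; apply: (K'E [:: 2; 0; 1]%N) => //; apply: order_312_cab.
- by move=> H' t x px; apply: (K'E [:: 2; 1; 0]%N) => //; apply: order_321_cab.
- by move=> H' t x px; apply: (K'E [:: 0; 1; 2]%N) => //; apply: order_123_cab.
by move=> H' t x px; apply: (K'E [:: 1; 0; 2]%N) => //; apply: order_213_cab.
Qed.

Lemma top_pt_natural H H' (t : mor H' H) (a b c d e f : mor H R) :
  (fun w => top_pt a b c d e f w ∘ t) =
  top_pt (a ∘ t) (b ∘ t) (c ∘ t) (d ∘ t) (e ∘ t) (f ∘ t).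
Proof. by apply: funext => w; rewrite lookupS /= mcomp_0r. Qed.

Lemma D2_relations (F : comPzRingType) (y : seq nat -> F) : is_pt cD2 y ->
  [/\ y [:: 0%N] * y [:: 0%N] = 0, y [:: 1%N] * y [:: 1%N] = 0 &
      y [:: 0%N] * y [:: 1%N] = 0].
Proof. by move=> py; split; rewrite (pt_mul py (L := [::])). Qed.

Lemma jacobi_sum :
  add_tangent
    (add_tangent
      (icon_bracket xi1 (icon_bracket xi2 xi3))
      (icon_push (rotate_bca A B C) (icon_bracket xi2 (icon_bracket xi3 xi1))))
    (icon_push (rotate_cab A B C) (icon_bracket xi3 (icon_bracket xi1 xi2)))
  = zero_tangent (dirac M ⟨a0, ⟨b0, c0⟩⟩).
Proof.
(* [L] follows the first bracket along one axis of [D(2)] and the second along the other; [L'] does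
   the same for the sum of these two and the third bracket. *)
pose L H (s : mor H G) (y : seq nat -> mor H R) :=
  let a := y [:: 0%N] in let b := y [:: 1%N] in
  val_at K s (top_pt a (b - a) (- b) (b - a) (- b) a).
pose L' H (s : mor H G) (y : seq nat -> mor H R) :=
  let a := y [:: 0%N] in let b := y [:: 1%N] in
  val_at K s (top_pt (a - b) 0 (b - a) 0 (b - a) (a - b)).
have natL : natural cD2 L.
  move=> H s y H' t /D2_relations[aa bb ab].
  rewrite /L (val_at_natural K) ?top_pt_natural ?mcomp_subr ?mcomp_oppr //.
  exact: bracket_sum_pt.
have natL' : natural cD2 L'.
  move=> H s y H' t /D2_relations[aa bb ab].
  rewrite /L' (val_at_natural K) ?top_pt_natural ?mcomp_subr ?mcomp_0r //.
  exact: bracket_opp_pt.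
have mX := @microlinear_dist _ R M (A × (B × C)) mM.
apply: expo_ext => H s d.
rewrite (add_tangent_eval KL mX natL') => [|H' t y py|H' t y py].
(* On the diagonal all six coefficients cancel. The base point is left, where every icon is a Dirac
   distribution. *)
- rewrite app_lam weakenE /L' /lookup /= subrr.
  have -> : top_pt 0 0 0 0 0 0 = (fun=> 0) :> (seq nat -> mor H R).
    by apply: esym; apply: lookup_eq.
  rewrite (K_cube (mem_head _ _)); last exact: is_pt0.
  rewrite /cube /pick_order /= /icon_at to_D0.
  rewrite (app_icon0 _ icon1) (app_icon0 _ icon2) (app_icon0 _ icon3).
  by rewrite /order_123 !conv_dirac diracS !compE.
(* Along the first axis [L'] has the values of [L] on its diagonal, which is the inner sum. *)
- have b0' : y [:: 1%N] = 0 by rewrite py.1.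
  rewrite (add_tangent_eval KL mX natL) => [|H'' t' z pz|H'' t' z pz].
  + rewrite /L /L' /lookup /= b0' valD_to_D ?(is_pt_sq _ py) //.
    by rewrite !subrr !sub0r subr0.
  + have z1 : z [:: 1%N] = 0 by rewrite pz.1.
    by rewrite bracket1_eval /L z1 valD_to_D ?(is_pt_sq _ pz) // !sub0r oppr0.
  have z0 : z [:: 0%N] = 0 by rewrite pz.1.
  by rewrite bracket2_eval /L z0 valD_to_D ?(is_pt_sq _ pz) // !subr0.
have a0' : y [:: 0%N] = 0 by rewrite py.1.
by rewrite bracket3_eval /L' a0' valD_to_D ?(is_pt_sq _ py) // !subr0 !sub0r.
Qed.

End JacobiSum.

Theorem theorem6 (E : universe) (R : ring_object E) (HR : kock_lawvere R)
    (M : E) (HM : microlinear R M) (A B C : E)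
    (G : E) (a0 : mor G A) (b0 : mor G B) (c0 : mor G C)
    (xi1 : mor G (D R ⇒ dist M A)) (xi2 : mor G (D R ⇒ dist M B))
    (xi3 : mor G (D R ⇒ dist M C))
    (Hxi1 : is_icon1 a0 xi1) (Hxi2 : is_icon1 b0 xi2) (Hxi3 : is_icon1 c0 xi3) :
  add_tangent
    (add_tangent
      (icon_bracket xi1 (icon_bracket xi2 xi3))
      (icon_push (rotate_bca A B C) (icon_bracket xi2 (icon_bracket xi3 xi1))))
    (icon_push (rotate_cab A B C) (icon_bracket xi3 (icon_bracket xi1 xi2)))
  = zero_tangent (dirac M ⟨a0, ⟨b0, c0⟩⟩).
Proof.
have [K K_cube] := glue HR (@microlinear_dist _ R M (A × (B × C)) HM)
  (fun w _ => cube_natural xi1 xi2 xi3 (w := w)) (cube_compat Hxi1 Hxi2 Hxi3).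
exact: (jacobi_sum HR HM Hxi1 Hxi2 Hxi3 K_cube).
Qed.
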